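(* There exists a positive absolute constant $C$ such that the following holds. Let $\Omega\subset\mathbb{R}^d$ be compact, let $\mu$ be a probability measure on $\Omega$, let $n\ge 2$ be an integer, let $K\ge 1$, and let $X_n$ be a linear subspace of $\mathcal{C}(\Omega)$ of dimension at most $n$ satisfying $$\|f\|_\infty\le \sqrt{Kn}\,\|f\|_{L_2(\Omega,\mu)}\qquad\text{for all } f\in X_n .$$ Then for every $\varepsilon\in(0,1)$ there are a positive integer $m\le C\varepsilon^{-2}Kn\log n$ and points $\xi^1,\dots,\xi^m\in\Omega$ such that for all $f\in X_n$ both $$(1-\varepsilon)\|f\|_{L_1(\Omega,\mu)}\le \frac1m\sum_{j=1}^m|f(\xi^j)|\le (1+\varepsilon)\|f\|_{L_1(\Omega,\mu)}$$ and $$(1-\varepsilon)\|f\|_{L_2(\Omega,\mu)}^2\le \frac1m\sum_{j=1}^m|f(\xi^j)|^2\le (1+\varepsilon)\|f\|_{L_2(\Omega,\mu)}^2 .$$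
   Context: $\mathcal{C}(\Omega)$ is the space of (real) continuous functions on $\Omega$, $\|f\|_\infty=\max_{x\in\Omega}|f(x)|$, and $\|f\|_{L_p(\Omega,\mu)}=(\int_\Omega|f|^p\,d\mu)^{1/p}$ for $1\le p<\infty$, where $\mu$ is a Borel probability measure. $\log$ is the natural logarithm. The points $\xi^1,\dots,\xi^m$ form a finite indexed family; repetitions are allowed. ''Absolute constant'' means independent of $d,\Omega,\mu,n,K,X_n,\varepsilon$. *)

(* Defs.v *)
From HB Require Import structures.
From mathcomp Require Import all_boot all_order all_algebra.
From mathcomp Require Import all_classical all_reals all_analysis.

Set Implicit Arguments.
Unset Strict Implicit.
Unset Printing Implicit Defensive.

Import Order.TTheory GRing.Theory Num.Theory.
Import numFieldNormedType.Exports.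

Local Open Scope classical_set_scope.
Local Open Scope ring_scope.

(* The subset A as a type of its own, with the subspace topology.  Measurable
   types are required to be pointed, hence the proof that A is nonempty. *)
Definition nonempty_subtype (T : topologicalType) (A : set T)
  (A0 : A !=set0) : Type := set_type A.

HB.instance Definition _ (T : topologicalType) (A : set T) (A0 : A !=set0) :=
  Topological.copy (nonempty_subtype A0) (set_type A).

Definition nonempty_subtype_point (T : topologicalType) (A : set T)
    (A0 : A !=set0) : nonempty_subtype A0 :=
  SigSub (mem_set (projT2 (cid A0))).

HB.instance Definition _ (T : topologicalType) (A : set T) (A0 : A !=set0) :=
  isPointed.Build (nonempty_subtype A0) (nonempty_subtype_point A0).

(* Carrier T, equipped with the sigma-algebra generated by the open sets. *)
Definition borelType (T : ptopologicalType) := g_sigma_algebraType (@open T).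

Definition sup_norm (R : realType) (T : Type) (f : T -> R) : \bar R :=
  ereal_sup (range (fun x => `|f x|%:E)).

Definition linear_subspace (R : realType) (V : lmodType R) (X : set V) : Prop :=
  GRing.submod_closed [in X].

Definition dim_le (R : realType) (V : lmodType R) (X : set V) (n : nat) : Prop :=
  exists2 u : 'I_n -> V, (forall i, X (u i)) &
    forall f, X f -> exists a : 'I_n -> R, f = \sum_(i < n) a i *: u i.

(* Main.v *)
Require Import Defs.
From HB Require Import structures.
From mathcomp Require Import all_boot all_order all_algebra.
From mathcomp Require Import all_classical all_reals all_analysis.
From mathcomp Require Import perm measurable_realfun ring lra zify.

Set Implicit Arguments.
Unset Strict Implicit.
Unset Printing Implicit Defensive.

Import Order.TTheory GRing.Theory Num.Theory.
Import numFieldNormedType.Exports.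

Local Open Scope classical_set_scope.
Local Open Scope ring_scope.

(** Instead of sampling at random, start from a huge equally weighted sample that
    reproduces the L1 and L2 norms of X up to eps/4 (quantize an orthonormal
    basis and round the measures of the level cells), and halve it repeatedly:
    pair up the points and keep one point of each pair, according to a choice of
    signs.  With N points, and B bounding |f|^2 / ||f||_2^2, a good choice of signs
    changes both norms by a relative amount O(sqrt(B log n / N)); these errors
    form a geometric series dominated by its last term, reached at
    m ~ eps^-2 B log n.

    Good signs exist on average.  For L2, the sum of e_j v_j v_j^T is bounded by
    trace moments of order 2p ~ log n (Rudelson's lemma, proved as a matrix
    Khintchine inequality).  For L1, contraction removes the absolute values
    inside, and the linear process sum_j e_j f(x_j) is the average of f H with
    H = sum_j e_j D(., x_j), D being the reproducing kernel.  Changing the density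
    by an almost-Auerbach basis gives |f| <= 2 n rho ||f||_1, so that moments of H
    of order 2p with 4^p >= n already control the supremum over the unit ball. *)

Lemma ler_expn2r (R : realType) (x y : R) (n : nat) :
  0 <= x -> x <= y -> x ^+ n <= y ^+ n.
Proof. by move=> x0 xy; rewrite lerXn2r// nnegrE// (le_trans x0). Qed.

(** * The Euclidean inner product of column vectors, and traces *)

Definition dot (R : realType) (r : nat) (a b : 'cV[R]_r) : R :=
  \sum_k a k 0 * b k 0.

Section Dot.
Variables (R : realType) (r : nat).
Implicit Types (a b c : 'cV[R]_r) (M : 'M[R]_r).

Lemma dotC a b : dot a b = dot b a.
Proof. by apply: eq_bigr => k _; rewrite mulrC. Qed.

Lemma dotE a b : dot a b = (a^T *m b) 0 0.
Proof. by rewrite mxE; apply: eq_bigr => k _; rewrite mxE. Qed.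

Lemma dotDr a b c : dot a (b + c) = dot a b + dot a c.
Proof. by rewrite -big_split; apply: eq_bigr => k _; rewrite mxE mulrDr. Qed.

Lemma dotZr t a b : dot a (t *: b) = t * dot a b.
Proof. by rewrite mulr_sumr; apply: eq_bigr => k _; rewrite mxE; ring. Qed.

Lemma dotZl t a b : dot (t *: a) b = t * dot a b.
Proof. by rewrite dotC dotZr dotC. Qed.

Lemma dotBr a b c : dot a (b - c) = dot a b - dot a c.
Proof. by rewrite dotDr -scaleN1r dotZr mulN1r. Qed.

Lemma dot0r a : dot a 0 = 0.
Proof. by apply: big1 => k _; rewrite mxE mulr0. Qed.

Lemma dot_sumr (I : finType) a (F : I -> 'cV[R]_r) :
  dot a (\sum_i F i) = \sum_i dot a (F i).
Proof. exact: (big_morph _ (dotDr a) (dot0r a)). Qed.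

Lemma dot_mulmx a M b : dot a (M *m b) = dot (M^T *m a) b.
Proof. by rewrite !dotE trmx_mul trmxK mulmxA. Qed.

Lemma dot_ge0 a : 0 <= dot a a.
Proof. by apply: sumr_ge0 => k _; rewrite -expr2 sqr_ge0. Qed.

Lemma dot_eq0 a : dot a a = 0 -> a = 0.
Proof.
move=> /eqP; rewrite psumr_eq0; last by move=> k _; rewrite -expr2 sqr_ge0.
move=> /allP a0; apply/matrixP => i j; rewrite ord1 mxE.
by have := a0 i (mem_index_enum _); rewrite -expr2 sqrf_eq0 => /eqP.
Qed.

Lemma dot_cauchy_schwarz a b : dot a b ^+ 2 <= dot a a * dot b b.
Proof.
have [->|b0] := eqVneq b 0; first by rewrite !dot0r expr0n mulr0.
have bb : 0 < dot b b.
  by rewrite lt_def dot_ge0 andbT; apply: contra_neq b0; apply: dot_eq0.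
have := dot_ge0 (dot b b *: a - dot a b *: b).
rewrite !dotBr ![dot (_ - _) _]dotC !dotBr !dotZr !dotZl (dotC b a).
have -> : dot b b * (dot b b * dot a a) - dot a b * (dot b b * dot a b) -
  (dot b b * (dot a b * dot a b) - dot a b * (dot a b * dot b b)) =
  dot b b * (dot a a * dot b b - dot a b ^+ 2) by ring.
by rewrite pmulr_rge0// subr_ge0.
Qed.

Lemma dot_delta a k : dot a (delta_mx k 0) = a k 0.
Proof.
rewrite /dot (bigD1 k)//= mxE !eqxx mulr1 big1 ?addr0// => i /negPf ik.
by rewrite mxE ik mulr0.
Qed.

Lemma mul_outer a b : (a *m a^T) *m b = dot a b *: a.
Proof.
rewrite -mulmxA; apply/matrixP => i j; rewrite !ord1 !mxE big_ord1 dotE.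
by rewrite mulrC.
Qed.

Lemma mxtraceE M : \tr M = \sum_k dot (delta_mx k 0) (M *m delta_mx k 0).
Proof.
apply: eq_bigr => k _; rewrite dotC dot_delta mxE (bigD1 k)//= mxE !eqxx mulr1.
by rewrite big1 ?addr0// => i /negPf ik; rewrite mxE ik mulr0.
Qed.

Lemma mxtrace_outer a M : \tr (a *m a^T *m M) = dot a (M *m a).
Proof.
by rewrite -mulmxA mxtrace_mulC dotE /mxtrace big_ord1 mulmxA.
Qed.

End Dot.

(** * Moments of a symmetric matrix at a vector *)

Lemma trmx_exp (R : realType) (r : nat) (M : 'M[R]_r) (k : nat) :
  (M ^+ k)^T = M^T ^+ k.
Proof.
elim: k => [|k IH]; first by rewrite !expr0 trmx1.
by rewrite exprS trmx_mul IH exprSr.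
Qed.

Section Moments.
Variables (R : realType) (r : nat) (M : 'M[R]_r).
Hypothesis MT : M^T = M.
Implicit Types (y : 'cV[R]_r).

Lemma dot_expD y i j :
  dot y (M ^+ (i + j) *m y) = dot (M ^+ i *m y) (M ^+ j *m y).
Proof. by rewrite exprD -mulmxA dot_mulmx trmx_exp MT. Qed.

Lemma dot_exp_even_ge0 y k : 0 <= dot y (M ^+ (k + k) *m y).
Proof. by rewrite dot_expD dot_ge0. Qed.

(* The numbers |M^i y| form a log-convex sequence. *)
Lemma norm_exp_root (y : 'cV[R]_r) (k : nat) : dot y y = 1 -> (0 < k)%N ->
  exists2 al : R, 0 <= al & al ^+ (k + k) = dot y (M ^+ (k + k) *m y) /\
    forall i, (i <= k)%N -> Num.sqrt (dot (M ^+ i *m y) (M ^+ i *m y)) <= al ^+ i.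
Proof.
move=> y1 k0; pose g i : R := Num.sqrt (dot (M ^+ i *m y) (M ^+ i *m y)).
have g0 i : 0 <= g i by rewrite sqrtr_ge0.
have gE i : g i ^+ 2 = dot y (M ^+ (i + i) *m y).
  by rewrite sqr_sqrtr ?dot_ge0// dot_expD.
have glc i : g i.+1 ^+ 2 <= g i * g i.+2.
  rewrite gE addSnnS dot_expD (le_trans (ler_norm _))// -sqrtr_sqr -sqrtrM ?dot_ge0//.
  by rewrite ler_sqrt ?dot_cauchy_schwarz// mulr_ge0 ?dot_ge0.
(* Since [g 0 = 1], log-convexity makes [g i] to the power [1/i] nondecreasing in [i]; this is the
   same statement without roots. *)
have gS i : g i ^+ i.+1 <= g i.+1 ^+ i.
  elim: i => [|i IH]; first by rewrite expr1 expr0 /g expr0 mul1mx y1 sqrtr1.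
  have [->|gi] := eqVneq (g i.+1) 0; first by rewrite expr0n exprn_ge0.
  have gi0 : 0 < g i.+1 by rewrite lt_def gi g0.
  rewrite -(ler_pM2l (exprn_gt0 i gi0)) -exprD.
  have -> : (i + i.+2 = 2 * i.+1)%N by rewrite mul2n -addnn addSnnS.
  rewrite exprM (le_trans (_ : _ <= (g i * g i.+2) ^+ i.+1))//.
    by apply: ler_expn2r; rewrite ?exprn_ge0.
  by rewrite exprMn ler_wpM2r ?exprn_ge0.
exists (g k `^ k%:R^-1); first exact: powR_ge0.
have alk : (g k `^ k%:R^-1) ^+ k = g k.
  by rewrite -powR_mulrn ?powR_ge0// -powRrM mulVf ?pnatr_eq0 -?lt0n// powRr1.
split; first by rewrite -gE addnn -muln2 exprM alk.
set al := _ `^ _ in alk *.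
suff : forall j, (j <= k)%N -> g (k - j)%N <= al ^+ (k - j).
  by move=> H i ik; have := H (k - i)%N (leq_subr _ _); rewrite subKn.
elim=> [|j IH] jk; first by rewrite subn0 alk.
have := IH (ltnW jk); have -> : (k - j = (k - j.+1).+1)%N by rewrite -subSn.
set i := (k - j.+1)%N => gi; rewrite -(ler_pXn2r (ltn0Sn i)) ?nnegrE ?exprn_ge0 ?powR_ge0//.
rewrite (le_trans (gS i))// -exprM mulnC exprM.
by rewrite ler_expn2r ?exprn_ge0 ?powR_ge0.
Qed.

(** An exponent at most [2k] splits into two exponents at most [k], and Cauchy-Schwarz reduces the
    moment to the norms of [norm_exp_root]. Odd moments are covered as well. *)
Lemma dot_exp_root (y : 'cV[R]_r) (k : nat) : dot y y = 1 ->
  exists2 al : R, 0 <= al & al ^+ (k + k) = dot y (M ^+ (k + k) *m y) /\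
    forall i, (i <= k + k)%N -> `|dot y (M ^+ i *m y)| <= al ^+ i.
Proof.
move=> y1; have [->|k0] := posnP k.
  exists 1; rewrite // expr1n expr0 mul1mx y1; split=> // i; rewrite leqn0 => /eqP ->.
  by rewrite expr0 mul1mx y1 normr1.
have [al al0 [alE alP]] := norm_exp_root y1 k0; exists al => //; split=> // i ik.
have [i1 [i2 [ -> i1k i2k]]] : exists i1 i2, [/\ i = (i1 + i2)%N, (i1 <= k)%N & (i2 <= k)%N].
  have [ik'|ki] := leqP i k; first by exists i, 0%N; rewrite addn0.
  by exists k, (i - k)%N; rewrite subnKC ?(ltnW ki)// leq_subLR.
rewrite dot_expD exprD (le_trans _ (ler_pM _ _ (alP _ i1k) (alP _ i2k))) ?sqrtr_ge0//.
by rewrite -sqrtrM ?dot_ge0// -sqrtr_sqr ler_sqrt ?dot_cauchy_schwarz// mulr_ge0 ?dot_ge0.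
Qed.

End Moments.

(** For a unit vector the two moments are at most [al^i] and [be^(2k-i)], whose product is at most
    the larger of [al^(2k)] and [be^(2k)], hence at most their sum. Both sides have degree 4 in [y],
    which allows the normalization. [X] and [Y] need not commute. *)
Lemma dot_exp_mixed (R : realType) (r : nat) (X Y : 'M[R]_r) (y : 'cV[R]_r) (k i : nat) :
  X^T = X -> Y^T = Y -> (i <= k + k)%N ->
  dot y (X ^+ i *m y) * dot y (Y ^+ (k + k - i) *m y) <=
  dot y y * (dot y (X ^+ (k + k) *m y) + dot y (Y ^+ (k + k) *m y)).
Proof.
move=> XT YT ik; have [->|y0] := eqVneq y 0; first by rewrite !(mulmx0, dot0r) mul0r.
have yy : 0 < dot y y.
  by rewrite lt_def dot_ge0 andbT; apply: contra_neq y0; apply: dot_eq0.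
set s := Num.sqrt (dot y y); have s0 : 0 < s by rewrite sqrtr_gt0.
have ss : s ^+ 2 = dot y y by rewrite sqr_sqrtr ?dot_ge0.
pose z := s^-1 *: y; have yz : y = s *: z by rewrite scalerA mulfV ?gt_eqF// scale1r.
have z1 : dot z z = 1 by rewrite dotZr dotZl -ss; field; rewrite gt_eqF.
have [al al0 [alE alP]] := dot_exp_root XT k z1.
have [be be0 [beE beP]] := dot_exp_root YT k z1.
have E (M : 'M[R]_r) : dot y (M *m y) = s ^+ 2 * dot z (M *m z).
  by rewrite yz -scalemxAr dotZr dotZl mulrA.
rewrite -ss !E -mulrDr mulrACA [X in _ <= X]mulrA ler_pM2l ?mulr_gt0 ?exprn_gt0//.
rewrite (le_trans (ler_norm _))// normrM.
rewrite (le_trans (ler_pM _ _ (alP _ ik) (beP _ (leq_subr _ _))))//.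
rewrite -alE -beE; set l := (k + k)%N in ik *.
have [ab|/ltW ba] := leP al be.
  rewrite (le_trans (_ : _ <= be ^+ i * be ^+ (l - i)))//.
    by rewrite ler_wpM2r ?exprn_ge0// ler_expn2r.
  by rewrite -exprD subnKC// ler_wpDl ?exprn_ge0.
rewrite (le_trans (_ : _ <= al ^+ i * al ^+ (l - i)))//.
  by rewrite ler_wpM2l ?exprn_ge0// ler_expn2r.
by rewrite -exprD subnKC// ler_wpDr ?exprn_ge0.
Qed.

(** * Sign vectors and sums over all of them *)

Notation signs m := {ffun 'I_m -> bool}.

Section Signs.
Variables (R : realType) (m : nat).
Implicit Types (e : signs m) (i j : 'I_m).

Definition sgn e j : R := (-1) ^+ (e j).

Definition flip j e : signs m := [ffun i => (i == j) (+) e i].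

Lemma flipK j : involutive (flip j).
Proof. by move=> e; apply/ffunP => i; rewrite !ffunE addbA addbb. Qed.

Lemma sgn_flip j e i : sgn (flip j e) i = if i == j then - sgn e i else sgn e i.
Proof. by rewrite /sgn ffunE; case: eqP => //= _; rewrite signrN. Qed.

Lemma sgn_sqr e j : sgn e j * sgn e j = 1.
Proof. by rewrite -expr2 sqrr_sign. Qed.

Lemma sum_flip j (F : signs m -> R) : \sum_e F e = \sum_e F (flip j e).
Proof. exact: reindex_inj (inv_inj (flipK j)). Qed.

Lemma sum_flip_half j (F : signs m -> R) :
  \sum_e F e = 2^-1 * \sum_e (F e + F (flip j e)).
Proof. by rewrite big_split/= -sum_flip; lra. Qed.

Definition negs e : signs m := [ffun i => ~~ e i].

Lemma sgn_negs e i : sgn (negs e) i = - sgn e i.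
Proof. by rewrite /sgn ffunE signrN. Qed.

Lemma sum_negs (F : signs m -> R) : \sum_e F e = \sum_e F (negs e).
Proof.
apply: reindex_inj; apply: inv_inj => e.
by apply/ffunP => i; rewrite !ffunE negbK.
Qed.

End Signs.

(** * The matrix Khintchine inequality *)

Lemma subrXX_noncomm (A : pzRingType) (x y : A) (n : nat) :
  x ^+ n - y ^+ n = \sum_(i < n) x ^+ i * (x - y) * y ^+ (n.-1 - i).
Proof.
elim: n => [|n IH]; first by rewrite big_ord0 subrr.
rewrite big_ord_recr/= subnn expr0 mulr1.
rewrite (eq_bigr (fun i : 'I_n => x ^+ i * (x - y) * y ^+ (n.-1 - i) * y)); last first.
  move=> i _; rewrite -[RHS]mulrA -exprSr; congr (_ * _ ^+ _).
  by have := ltn_ord i; lia.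
rewrite -mulr_suml -IH !exprSr mulrBl mulrBr.
by rewrite [RHS]addrC addrA subrK.
Qed.

Section Khintchine.
Variables (R : realType) (r m : nat) (s : 'I_m -> R) (y : 'I_m -> 'cV[R]_r).

(** The weights [s] let one statement serve twice: with [s = 1] for the quadratic forms, and with
    all [y j = 1] in dimension one for scalar sums. *)
Definition radsum (e : signs m) : 'M[R]_r :=
  \sum_j (sgn R e j * s j) *: (y j *m (y j)^T).

Lemma radsum_tr e : (radsum e)^T = radsum e.
Proof.
rewrite /radsum raddf_sum; apply: eq_bigr => j _.
by rewrite /= linearZ /= trmx_mul trmxK.
Qed.

Lemma dot_radsum e z :
  dot z (radsum e *m z) = \sum_j sgn R e j * s j * dot (y j) z ^+ 2.
Proof.
rewrite /radsum mulmx_suml dot_sumr; apply: eq_bigr => j _.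
by rewrite -scalemxAl dotZr mul_outer dotZr (dotC z) expr2.
Qed.

Lemma radsum_flip e j :
  radsum e - radsum (flip j e) = (2 * (sgn R e j * s j)) *: (y j *m (y j)^T).
Proof.
rewrite /radsum -sumrB (bigD1 j)//= big1 ?addr0.
  by rewrite sgn_flip eqxx -scalerBl mulNr opprK mulr2n mulrDl mul1r.
by move=> i /negPf ij; rewrite sgn_flip ij subrr.
Qed.

(* Pairing [e] with [flip j e] is a discrete integration by parts. *)
Lemma sum_sgn_dot_radsum k j :
  \sum_e sgn R e j * s j * dot (y j) (radsum e ^+ (k + k).+1 *m y j) <=
  2 * (k + k).+1%:R *
    \sum_e s j ^+ 2 * dot (y j) (y j) * dot (y j) (radsum e ^+ (k + k) *m y j).
Proof.
rewrite (sum_flip_half j).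
have H e : sgn R e j * s j * dot (y j) (radsum e ^+ (k + k).+1 *m y j) +
   sgn R (flip j e) j * s j * dot (y j) (radsum (flip j e) ^+ (k + k).+1 *m y j)
   <= 2 * (k + k).+1%:R * (s j ^+ 2 * dot (y j) (y j)) *
     (dot (y j) (radsum e ^+ (k + k) *m y j) +
      dot (y j) (radsum (flip j e) ^+ (k + k) *m y j)).
  (* The sign changes under the flip, so the two terms combine into a difference of powers, which
     telescopes. Each summand contains the rank-one difference of the two matrices and therefore
     factors into two scalar moments, one for each matrix. *)
  rewrite sgn_flip eqxx !mulNr -mulrBr -dotBr -mulmxBl subrXX_noncomm radsum_flip.
  rewrite mulmx_suml dot_sumr mulr_sumr.
  rewrite (le_trans (_ : _ <= \sum_(i < (k + k).+1) 2 * (s j ^+ 2 * dot (y j) (y j)) *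
     (dot (y j) (radsum e ^+ (k + k) *m y j) +
      dot (y j) (radsum (flip j e) ^+ (k + k) *m y j))))//; last first.
    by rewrite sumr_const card_ord -mulr_natr; lra.
  apply: ler_sum => i _ /=.
  have ik : (i <= k + k)%N by rewrite -ltnS.
  have := dot_exp_mixed (y j) (radsum_tr e) (radsum_tr (flip j e)) ik.
  rewrite -!mulmxE -scalemxAr -!scalemxAl dotZr -!mulmxA.
  set P := _ ^+ (_ - _); set Q := radsum e ^+ i => {}H.
  rewrite [(y j)^T *m _]mx11_scalar -dotE mul_mx_scalar -scalemxAr dotZr.
  have -> : sgn R e j * s j * (2 * (sgn R e j * s j) *
    (dot (y j) (P *m y j) * dot (y j) (Q *m y j))) = 2 * s j ^+ 2 *
    (dot (y j) (Q *m y j) * dot (y j) (P *m y j)) * (sgn R e j * sgn R e j) by ring.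
  rewrite sgn_sqr mulr1 [X in _ <= X * _]mulrA -[X in _ <= X]mulrA. apply: ler_wpM2l; first by rewrite mulr_ge0 ?sqr_ge0.
  exact: H.
rewrite (le_trans (ler_wpM2l _ (ler_sum _ (fun e _ => H e))))// -!mulr_sumr.
rewrite big_split/= -(sum_flip j (fun e => dot (y j) (radsum e ^+ (k + k) *m y j))).
by lra.
Qed.

(** Induction on [k]. One factor of the trace is expanded as a signed sum, integration by parts
    removes the sign and one more factor, and the hypothesis on [kap], applied to the columns of the
    [k]-th power, restores a trace. A step costs [2(2k+1) kap], and [2(2k+1) <= 4p] for [k < p]. *)
Lemma matrix_khintchine (kap : R) (p k : nat) : 0 <= kap ->
  (forall z, \sum_j s j ^+ 2 * dot (y j) (y j) * dot (y j) z ^+ 2 <= kap * dot z z) ->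
  (k <= p)%N ->
  \sum_e \tr (radsum e ^+ (k + k)) <=
    #|{: signs m}|%:R * r%:R * ((4 * p)%:R * kap) ^+ k.
Proof.
move=> kap0 Hkap; elim: k => [|k IH] kp.
  rewrite mulr1 (eq_bigr (fun=> r%:R)) => [|e _]; last by rewrite expr0 mxtrace1.
  by rewrite sumr_const mulr_natl.
have -> : \sum_e \tr (radsum e ^+ (k.+1 + k.+1)) =
    \sum_j \sum_e sgn R e j * s j * dot (y j) (radsum e ^+ (k + k).+1 *m y j).
  rewrite [RHS]exchange_big; apply: eq_bigr => e _; rewrite addSn addnS exprS.
  rewrite -mulmxE {1}/radsum mulmx_suml raddf_sum; apply: eq_bigr => j _.
  by rewrite /= -scalemxAl mxtraceZ mxtrace_outer.
rewrite (le_trans (ler_sum _ (fun j _ => sum_sgn_dot_radsum k j)))// -mulr_sumr exchange_big/=.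
have T e : \sum_j s j ^+ 2 * dot (y j) (y j) * dot (y j) (radsum e ^+ (k + k) *m y j)
    <= kap * \tr (radsum e ^+ (k + k)).
  rewrite mxtraceE mulr_sumr.
  under [X in _ <= X]eq_bigr do rewrite dot_expD ?radsum_tr//.
  rewrite (le_trans _ (ler_sum _ (fun l _ => Hkap _)))//.
  rewrite exchange_big; apply: ler_sum => j _ /=.
  rewrite -mulr_sumr dot_expD ?radsum_tr//; rewrite le_eqVlt; apply/orP; left.
  apply/eqP; congr (_ * _).
  by apply: eq_bigr => l _; rewrite dot_mulmx trmx_exp radsum_tr dot_delta expr2.
rewrite (le_trans (ler_wpM2l _ (ler_sum _ (fun e _ => T e))))//.
rewrite -mulr_sumr mulrA (le_trans (ler_wpM2l _ (IH (ltnW kp))))//.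
  by rewrite !mulr_ge0.
rewrite exprS; set C := _ * r%:R; set P := (_ * kap) ^+ k.
have P0 : 0 <= kap * (C * P) by rewrite !mulr_ge0// exprn_ge0// mulr_ge0.
have -> : 2 * (k + k).+1%:R * kap * (C * P) = 2 * (k + k).+1%:R * (kap * (C * P)) by ring.
have -> : C * ((4 * p)%:R * kap * P) = (4 * p)%:R * (kap * (C * P)) by ring.
by apply: ler_wpM2r => //; rewrite -natrM ler_nat; lia.
Qed.

End Khintchine.

(** * The contraction principle for suprema of signed sums *)

Section Contraction.
Variables (R : realType) (m : nat) (T : Type) (S : set T) (c : R).
Hypothesis S0 : S !=set0.
Implicit Types (t : 'I_m -> T -> R) (e : signs m) (j : 'I_m).

Definition rad t e (b : T) : R := \sum_j sgn R e j * t j b.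

Definition suprad t e : R := sup [set rad t e b | b in S].

Lemma norm_rad_le t e b : (forall j, `|t j b| <= c) -> `|rad t e b| <= m%:R * c.
Proof.
move=> tc; rewrite (le_trans (ler_norm_sum _ _ _))//.
have H j : `|sgn R e j * t j b| <= c by rewrite normrM normr_sign mul1r.
by rewrite (le_trans (ler_sum _ (fun j _ => H j)))// sumr_const card_ord mulr_natl.
Qed.

Lemma rad_le_suprad t e b : (forall j b, S b -> `|t j b| <= c) -> S b ->
  rad t e b <= suprad t e.
Proof.
move=> tc Sb; apply: ub_le_sup; last by exists b.
exists (m%:R * c) => _ [b' Sb' <-]; rewrite (le_trans (ler_norm _))//.
by apply: norm_rad_le => j; exact: tc.
Qed.

Lemma suprad_le t e x : (forall b, S b -> rad t e b <= x) -> suprad t e <= x.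
Proof.
move=> tx; apply: ge_sup => [|_ [b Sb <-]]; last exact: tx.
by case: S0 => b Sb; exists (rad t e b), b.
Qed.

(** After pairing [e] with [flip j e], the two suprema are tested at arbitrary [b] and [b']. The
    [j]-th coordinate contributes a difference of absolute values, at most the absolute value of the
    difference. According to its sign, the suprema for [t'] are tested at [b], [b'] or at [b'],
    [b]. *)
Lemma contraction_step t t' (j : 'I_m) :
  (forall j b, S b -> `|t' j b| <= c) ->
  (forall i b, i != j -> t i b = t' i b) -> (forall b, t j b = `|t' j b|) ->
  \sum_e suprad t e <= \sum_e suprad t' e.
Proof.
move=> tc tt' tj; rewrite (sum_flip_half j) [X in _ <= X](sum_flip_half j) ler_pM2l ?invr_gt0//.
apply: ler_sum => e _; rewrite -lerBrDr; apply: suprad_le => b Sb.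
rewrite lerBrDr addrC -lerBrDr; apply: suprad_le => b' Sb'; rewrite lerBrDr.
pose g b := \sum_(i | i != j) sgn R e i * t' i b.
have E b1 : rad t e b1 = sgn R e j * `|t' j b1| + g b1.
  rewrite /rad (bigD1 j)//= tj; congr (_ + _).
  by apply: eq_bigr => i ij; rewrite tt'.
have E1 b1 : rad t (flip j e) b1 = - sgn R e j * `|t' j b1| + g b1.
  rewrite /rad (bigD1 j)//= tj sgn_flip eqxx; congr (_ + _).
  by apply: eq_bigr => i ij; rewrite tt'// sgn_flip (negPf ij).
have E' b1 : rad t' e b1 = sgn R e j * t' j b1 + g b1 by rewrite /rad (bigD1 j).
have E'1 b1 : rad t' (flip j e) b1 = - sgn R e j * t' j b1 + g b1.
  rewrite /rad (bigD1 j)//= sgn_flip eqxx; congr (_ + _).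
  by apply: eq_bigr => i ij; rewrite sgn_flip (negPf ij).
have h1 := rad_le_suprad e tc Sb; have h2 := rad_le_suprad (flip j e) tc Sb'.
have h3 := rad_le_suprad e tc Sb'; have h4 := rad_le_suprad (flip j e) tc Sb.
move: h1 h2 h3 h4; rewrite E E1 !E' !E'1 => h1 h2 h3 h4.
have : sgn R e j * (`|t' j b| - `|t' j b'|) <= `|sgn R e j * (t' j b - t' j b')|.
  by rewrite (le_trans (ler_norm _))// !normrM ler_wpM2l// ler_dist_dist.
have [/ger0_norm ->|/ltW/ler0_norm ->] := leP 0 (sgn R e j * (t' j b - t' j b')) => h; lra.
Qed.

(** The absolute values are removed one coordinate at a time; in the hybrid family [h k] the
    coordinates below [k] have already lost theirs. *)
Lemma contraction t : (forall j b, S b -> `|t j b| <= c) ->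
  \sum_e suprad (fun j b => `|t j b|) e <= \sum_e suprad t e.
Proof.
move=> tc; pose h k j b := if (j < k)%N then t j b else `|t j b|.
suff H k : (k <= m)%N -> \sum_e suprad (h 0%N) e <= \sum_e suprad (h k) e.
  rewrite (le_trans (H m (leqnn _)))// le_eqVlt; apply/orP; left; apply/eqP.
  by apply: eq_bigr => e _; congr suprad; apply/funext => j; apply/funext => b;
     rewrite /h ltn_ord.
elim: k => // k IH km; rewrite (le_trans (IH (ltnW km)))//.
apply: (@contraction_step _ _ (Ordinal km)).
- by move=> j b Sb; rewrite /h; case: ifP => _; rewrite ?normr_id tc.
- move=> i b ik; rewrite /h [in RHS]ltnS [in RHS]leq_eqVlt.
  have -> : (i == k :> nat) = false by apply: negbTE.
  by [].
- by move=> b; rewrite /h /= ltnn ltnSn.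
Qed.

End Contraction.

(** * Almost-Auerbach bases and change of density *)

Lemma det_row_subst (R : realType) (r : nat) (A : 'M[R]_r) (x : 'rV[R]_r) (k : 'I_r) :
  \det (\matrix_(i, j) if i == k then (x *m A) 0 j else A i j) = x 0 k * \det A.
Proof.
pose E : 'M[R]_r := \matrix_(i, j) if i == k then x 0 j else (i == j)%:R.
have -> : (\matrix_(i, j) if i == k then (x *m A) 0 j else A i j) = E *m A.
  apply/matrixP => i j; rewrite !mxE; case: eqP => [->|/eqP ik].
    by apply: eq_bigr => l _; rewrite mxE eqxx.
  rewrite (bigD1 i)//= mxE (negPf ik) eqxx mul1r big1 ?addr0// => l li.
  by rewrite mxE (negPf ik) eq_sym (negPf li) mul0r.
rewrite det_mulmx; congr (_ * _).
(* Column [k] of [E] vanishes off the diagonal, and the remaining minor is an identity matrix. *)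
rewrite (expand_det_col _ k) (bigD1 k)//= big1 ?addr0 => [|i ik]; last first.
  by rewrite mxE (negPf ik) mul0r.
rewrite mxE eqxx /cofactor addnn -mul2n exprM sqrrN !expr1n mul1r.
rewrite (_ : row' k (col' k E) = 1%:M) ?det1 ?mulr1//.
apply/matrixP => i j; rewrite !mxE eq_sym (negPf (neq_lift _ _)).
by rewrite (inj_eq lift_inj).
Qed.

Lemma norm_det_le (R : realType) (r : nat) (A : 'M[R]_r) (c : R) :
  (forall i j, `|A i j| <= c) -> `|\det A| <= \sum_(s : {perm 'I_r}) c ^+ r.
Proof.
move=> Ac; have H (s : {perm 'I_r}) : `|(-1) ^+ s * \prod_i A i (s i)| <= c ^+ r.
  rewrite normrM normr_sign mul1r normr_prod.
  have -> : c ^+ r = \prod_(i < r) c by rewrite prodr_const card_ord.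
  by apply: ler_prod => i _; rewrite normr_ge0 Ac.
by rewrite (le_trans (ler_norm_sum _ _ _))// (le_trans (ler_sum _ (fun s _ => H s))).
Qed.

(* An almost-Auerbach basis: its rows nearly maximize the determinant. *)
Lemma near_auerbach (R : realType) (r : nat) (S : set 'rV[R]_r) (c : R) :
  (forall b k, S b -> `|b 0 k| <= c) ->
  (exists2 A : 'M[R]_r, A \in unitmx & forall k, S (row k A)) ->
  exists2 A : 'M[R]_r, (forall k, S (row k A)) &
    forall b, S b -> exists2 x : 'rV[R]_r, b = x *m A & forall k, `|x 0 k| <= 2.
Proof.
move=> Sc [A0 A0u SA0].
pose D := [set `|\det A| | A in [set A : 'M[R]_r | forall k, S (row k A)]].
have A0D : D `|\det A0| by exists A0.
have supD : has_sup D.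
  split; first by exists `|\det A0|.
  exists (\sum_(s : {perm 'I_r}) c ^+ r) => _ [A SA <-]; apply: norm_det_le => i j.
  by have := Sc _ j (SA i); rewrite mxE.
have D0 : 0 < sup D.
  rewrite (lt_le_trans (_ : 0 < `|\det A0|))//; last by apply: ub_le_sup => //; case: supD.
  by rewrite normr_gt0 -unitfE -unitmxE.
(* [S] is not assumed closed, so the supremum may not be attained; settling for more than half of it
   is what makes the coordinate bound 2 instead of 1. *)
have [|_ [A SA <-] ltA] := sup_adherent (_ : 0 < sup D / 2) supD; first by rewrite divr_gt0.
have A_gt0 : 0 < `|\det A| by rewrite (le_lt_trans _ ltA)//; lra.
have Au : A \in unitmx by rewrite unitmxE unitfE -normr_gt0.
exists A => // b Sb; exists (b *m invmx A); first by rewrite mulmxKV.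
(* Cramer's rule: the coordinate times [\det A] is the determinant of [A] with row [k] replaced by
   [b], a competitor in [D]. *)
move=> k; rewrite -(ler_pM2r A_gt0) -normrM -det_row_subst mulmxKV//.
set B := \matrix_(i, j) _.
suff /(ub_le_sup (proj2 supD)) : D `|\det B| by move: ltA; lra.
exists B => // i; have [->|ik] := eqVneq i k.
  by rewrite (_ : row k B = b)//; apply/rowP => j; rewrite !mxE eqxx.
by rewrite (_ : row i B = row i A)//; apply/rowP => j; rewrite !mxE (negPf ik).
Qed.

Lemma sum_sqr_le_sqr_sum (R : realType) (I : finType) (x : I -> R) :
  (forall i, 0 <= x i) -> \sum_i x i ^+ 2 <= (\sum_i x i) ^+ 2.
Proof.
move=> x0; rewrite expr2 mulr_suml; apply: ler_sum => i _.
rewrite expr2 ler_wpM2l// (bigD1 i)//= ler_wpDr// sumr_ge0//.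
Qed.

(** The density is the average of the absolute values of an almost-Auerbach basis of the L1 unit
    ball [S]. Its mean is at most 1 because the basis lies in [S], and an element of [S], having
    coordinates at most 2, is pointwise at most twice the sum of those absolute values. *)
Lemma change_of_density (R : realType) (r : nat) (I : finType) (v : I -> 'cV[R]_r) (N : R) :
  1 <= N -> (forall a, \sum_i dot a (v i) ^+ 2 = N * dot a a) ->
  exists rho : I -> R, [/\ forall i, 0 <= rho i, N^-1 * \sum_i rho i <= 1 &
    forall a, N^-1 * \sum_i `|dot a (v i)| <= 1 ->
      forall i, `|dot a (v i)| <= 2 * r%:R * rho i].
Proof.
move=> N1 vN; have N0 : 0 < N by rewrite (lt_le_trans ltr01).
pose S := [set b : 'rV[R]_r | N^-1 * \sum_i `|dot b^T (v i)| <= 1].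
(* The l2 norm of the values is at most their l1 norm, so the frame identity and [1 <= N] bound the
   coordinates. This makes [S] bounded. *)
have coef (a : 'cV[R]_r) k : `|a k 0| <= \sum_i `|dot a (v i)|.
  rewrite -ler_sqr ?nnegrE ?sumr_ge0// real_normK ?num_real//.
  apply: le_trans (sum_sqr_le_sqr_sum _) => //.
  under eq_bigr do rewrite real_normK ?num_real//.
  rewrite vN (le_trans (_ : _ <= dot a a))//.
    rewrite /dot (bigD1 k)//= -expr2 ler_wpDr// sumr_ge0// => i _.
    by rewrite -expr2 sqr_ge0.
  by rewrite ler_peMl// dot_ge0.
have Sc b k : S b -> `|b 0 k| <= N.
  rewrite /S/= mulrC ler_pdivrMr// mul1r; apply: le_trans.
  by have := coef b^T k; rewrite mxE.
have [|A SA Ab] := near_auerbach Sc.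
  pose t (k : 'I_r) := N^-1 * \sum_i `|dot (delta_mx k 0) (v i)|.
  have t0 k : 0 <= t k by rewrite mulr_ge0 ?invr_ge0 ?sumr_ge0// ltW.
  (* Unit vectors shrunk into [S]; dividing by [1 + t k] avoids a zero denominator. *)
  exists (diag_mx (\row_k (1 + t k)^-1)).
    rewrite unitmxE det_diag unitfE; apply/prodf_neq0 => k _.
    by rewrite mxE invr_eq0 gt_eqF// ltr_wpDr.
  move=> k; rewrite /S/= (eq_bigr (fun i => (1 + t k)^-1 * `|dot (delta_mx k 0) (v i)|)).
    rewrite -mulr_sumr mulrCA -/(t k) mulrC ler_pdivrMr ?mul1r ?ltr_wpDr//.
    by rewrite lerDr.
  move=> i _; rewrite -[(1 + _)^-1]ger0_norm ?invr_ge0 ?addr_ge0// -normrM -dotZl.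
  congr (`|dot _ _|); apply/matrixP => l j; rewrite !ord1 !mxE eq_sym.
  by rewrite eqxx andbT mulr_natr.
exists (fun i => r%:R^-1 * \sum_k `|dot (row k A)^T (v i)|); split.
- by move=> i; rewrite mulr_ge0 ?invr_ge0 ?sumr_ge0.
- rewrite -mulr_sumr exchange_big/= mulrCA mulr_sumr.
  rewrite (le_trans (ler_wpM2l _ (ler_sum _ (fun k _ => SA k)))) ?invr_ge0//.
  rewrite sumr_const card_ord; have [->|r0] := posnP r; first by rewrite mulr0.
  by rewrite mulVf// pnatr_eq0 -lt0n.
- move=> a Sa i; have [|x ax x2] := Ab a^T; first by rewrite /S/= trmxK.
  have -> : a = \sum_k x 0 k *: (row k A)^T.
    by rewrite -[a]trmxK ax mulmx_sum_row raddf_sum; apply: eq_bigr => k _; rewrite /= linearZ.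
  rewrite dotC dot_sumr (le_trans (ler_norm_sum _ _ _))//.
  have -> : 2 * r%:R * (r%:R^-1 * \sum_k `|dot (row k A)^T (v i)|) =
      \sum_k 2 * `|dot (row k A)^T (v i)|.
    rewrite -mulr_sumr; have [r0|r0] := posnP r.
      by rewrite [\sum_k _]big1 ?mulr0// => k _; have := ltn_ord k; rewrite {2}r0.
    by rewrite mulrA -[2 * _ / _]mulrA mulfV ?mulr1// pnatr_eq0 -lt0n.
  by apply: ler_sum => k _; rewrite dotC dotZl normrM ler_wpM2r.
Qed.

(** * From moments to bounds for a single matrix or scalar *)

Lemma dot_exp_le_trace (R : realType) (r : nat) (X : 'M[R]_r) (z : 'cV[R]_r) (p : nat) :
  X^T = X -> dot z z = 1 -> dot z (X ^+ (p + p) *m z) <= \tr (X ^+ (p + p)).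
Proof.
move=> XT z1; rewrite mxtraceE dot_expD//.
have -> : dot (X ^+ p *m z) (X ^+ p *m z) =
    \sum_k dot (X ^+ p *m delta_mx k 0) z ^+ 2.
  apply: eq_bigr => k _; rewrite -expr2; congr (_ ^+ 2).
  by rewrite dotC dot_mulmx trmx_exp XT dot_delta.
apply: ler_sum => k _; rewrite dot_expD//.
by rewrite (le_trans (dot_cauchy_schwarz _ _))// z1 mulr1.
Qed.

(** By [dot_exp_root] with exponent 1, the quadratic form at a unit vector is at most the [2p]-th
    root of its [2p]-th moment, and that moment is at most the trace. *)
Lemma quadratic_le_trace_root (R : realType) (r : nat) (X : 'M[R]_r) (p : nat) (c : R)
    (a : 'cV[R]_r) : X^T = X -> (0 < p)%N -> 0 <= c ->
  \tr (X ^+ (p + p)) <= c ^+ (p + p) -> `|dot a (X *m a)| <= c * dot a a.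
Proof.
move=> XT p0 c0 Xc; have [->|a0] := eqVneq a 0.
  by rewrite mulmx0 !dot0r normr0 mulr0.
have aa : 0 < dot a a.
  by rewrite lt_def dot_ge0 andbT; apply: contra_neq a0; apply: dot_eq0.
set s := Num.sqrt (dot a a); have s0 : 0 < s by rewrite sqrtr_gt0.
have ss : s ^+ 2 = dot a a by rewrite sqr_sqrtr ?dot_ge0.
pose z := s^-1 *: a; have az : a = s *: z by rewrite scalerA mulfV ?gt_eqF// scale1r.
have z1 : dot z z = 1 by rewrite dotZr dotZl -ss; field; rewrite gt_eqF.
have [al al0 [alE alP]] := dot_exp_root XT p z1.
rewrite -ss az -scalemxAr dotZr dotZl mulrA -expr2 normrM [`|s ^+ 2|]ger0_norm ?sqr_ge0//.
rewrite mulrC ler_wpM2r ?sqr_ge0//.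
have := alP 1%N; rewrite addn_gt0 p0 !expr1 => /(_ isT) /le_trans; apply.
rewrite -(ler_pXn2r (_ : 0 < p + p)%N) ?nnegrE ?addn_gt0 ?p0//.
by rewrite alE (le_trans _ Xc)// dot_exp_le_trace.
Qed.

(** The matrix inequality in dimension one, where all the vectors are 1 and the trace is the scalar
    itself. *)
Lemma scalar_khintchine (R : realType) (m : nat) (s : 'I_m -> R) (kap : R) (p : nat) :
  0 <= kap -> \sum_j s j ^+ 2 <= kap ->
  \sum_e (\sum_j sgn R e j * s j) ^+ (p + p) <=
    #|{: signs m}|%:R * ((4 * p)%:R * kap) ^+ p.
Proof.
move=> kap0 sk; pose y (j : 'I_m) : 'cV[R]_1 := 1%:M.
have yy j : dot (y j) (y j) = 1 by rewrite dotE trmx1 mulmx1 mxE.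
have := @matrix_khintchine R 1 m s y kap p p kap0 _ (leqnn p); rewrite mulr1.
have E e k : \tr (radsum s y e ^+ k) = (\sum_j sgn R e j * s j) ^+ k.
  have -> : radsum s y e = (\sum_j sgn R e j * s j)%:M.
    rewrite raddf_sum; apply: eq_bigr => j _.
    by rewrite trmx1 mulmx1 scalemx1.
  rewrite -rmorphXn/=  /mxtrace big_ord1 mxE eqxx //.
under eq_bigr do rewrite E.
apply => z; rewrite (eq_bigr (fun j => s j ^+ 2 * dot z z)) => [|j _].
  by rewrite -mulr_suml ler_wpM2r// dot_ge0.
by rewrite yy mulr1; congr (_ * _); rewrite /dot !big_ord1 mxE eqxx mul1r expr2.
Qed.

Lemma exists_le_mean (R : realType) (I : finType) (F : I -> R) (c : R) (i0 : I) :
  \sum_i F i <= #|I|%:R * c -> exists i, F i <= c.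
Proof.
move=> Fc; apply: contrapT => /forallNP nF.
have cF i : c < F i by rewrite ltNge; apply/negP.
suff : #|I|%:R * c < \sum_i F i by rewrite ltNge Fc.
rewrite mulr_natl -sumr_const (eq_bigl xpredT)// -subr_gt0 -sumrB.
rewrite (bigD1 i0)//= ltr_pwDl ?subr_gt0// sumr_ge0// => i _.
by rewrite subr_ge0 ltW.
Qed.

(** * Choosing signs that are good for both norms *)

Section Signing.
Variables (R : realType) (r p m : nat) (v : bool * 'I_m -> 'cV[R]_r) (N B : R).
Hypotheses (N1 : 1 <= N) (B0 : 0 < B) (p0 : (0 < p)%N) (rp : (r <= 4 ^ p)%N).
Hypothesis vN : forall a, \sum_i dot a (v i) ^+ 2 = N * dot a a.
Hypothesis vB : forall i, dot (v i) (v i) <= B.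

(** [B * N] is the constant [kap] of both Khintchine inequalities below, so [lam] is the common
    scale of the signed sums: the [p]-th power in those bounds is [lam^(2p)]. *)
Let lam := Num.sqrt ((4 * p)%:R * (B * N)).

Let N0 : 0 < N. Proof. exact: lt_le_trans ltr01 N1. Qed.

Let N1_ge0 : 0 <= N^-1. Proof. by rewrite invr_ge0 ltW. Qed.

Let lam0 : 0 < lam.
Proof. by rewrite sqrtr_gt0 !mulr_gt0// ltr0n muln_gt0. Qed.

Let lam2p : ((4 * p)%:R * (B * N)) ^+ p = lam ^+ (p + p).
Proof. by rewrite addnn -mul2n exprM sqr_sqrtr// ltW// !mulr_gt0// ltr0n muln_gt0. Qed.

Lemma half_sum_le (b : bool) (F : bool * 'I_m -> R) : (forall i, 0 <= F i) ->
  \sum_j F (b, j) <= \sum_i F i.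
Proof.
move=> F0; have -> : \sum_i F i = \sum_b \sum_j F (b, j).
  by rewrite pair_bigA; apply: eq_bigr => -[].
rewrite big_bool/=.
by case: b; rewrite ?lerDl ?lerDr sumr_ge0.
Qed.

(** This is the reproducing property: [dot a (v j)] becomes the average over [i] of [dot a (v i)]
    against the kernel [dot (v j) (v i)]. *)
Lemma polarization a c : \sum_i dot a (v i) * dot c (v i) = N * dot a c.
Proof.
have H1 := vN (a + c); have H2 := vN a; have H3 := vN c.
move: H1; rewrite dotDr ![dot (a + c) _]dotC !dotDr (dotC c a) !mulrDr -H2 -H3.
rewrite (eq_bigr (fun i => dot a (v i) ^+ 2 + dot c (v i) ^+ 2 +
  2 * (dot a (v i) * dot c (v i)))); last first.
  by move=> i _; rewrite dotC dotDr !(dotC (v i)); ring.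
by rewrite !big_split/= -mulr_sumr; lra.
Qed.

Let S := [set a : 'cV[R]_r | N^-1 * \sum_i `|dot a (v i)| <= 1].

Let S0 : S 0.
Proof.
rewrite /S/= big1 ?mulr0// => i _.
by rewrite dotC dot0r normr0.
Qed.

Let Sbound b j a : S a -> `|dot a (v (b, j))| <= N.
Proof.
rewrite /S/= mulrC ler_pdivrMr// mul1r; apply: le_trans.
by rewrite (bigD1 (b, j))//= lerDl sumr_ge0.
Qed.

(** The point is a bound [U e] that does not depend on [a]. Averaged over the signs it is at most
    [lam * (2 + 4)], because the normalized moments of [H] and the mean of [rho] are at most 1. *)
Lemma sum_suprad_le (b : bool) :
  \sum_e suprad S (fun j a => dot a (v (b, j))) e <= #|{: signs m}|%:R * (6 * lam).
Proof.
have [rho [rho0 rho1 rhoP]] := change_of_density N1 vN.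
pose H e i := \sum_j sgn R e j * dot (v i) (v (b, j)).
have HE i : \sum_e (H e i / lam) ^+ (p + p) <= #|{: signs m}|%:R.
  under eq_bigr do rewrite expr_div_n.
  rewrite -mulr_suml ler_pdivrMr ?exprn_gt0// -lam2p.
  apply: scalar_khintchine; first by rewrite mulr_ge0// ltW.
  rewrite (le_trans (half_sum_le b (F := fun i' => dot (v i) (v i') ^+ 2) _))//.
    by move=> i'; rewrite sqr_ge0.
  by rewrite vN mulrC ler_wpM2r// ltW.
pose U e := lam * (2 + 4 * (N^-1 * \sum_i rho i * (H e i / lam) ^+ (p + p))).
have HU e : suprad S (fun j a => dot a (v (b, j))) e <= U e.
  apply: suprad_le; first by exists 0.
  move=> a Sa; rewrite /rad.
  have -> : \sum_j sgn R e j * dot a (v (b, j)) = N^-1 * \sum_i dot a (v i) * H e i.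
    under [in RHS]eq_bigr do rewrite mulr_sumr.
    rewrite exchange_big/= mulr_sumr; apply: eq_bigr => j _.
    rewrite (eq_bigr (fun i => sgn R e j * (dot a (v i) * dot (v (b, j)) (v i)))).
      by rewrite -mulr_sumr polarization; field; rewrite gt_eqF.
    by move=> i _; rewrite (dotC (v i)); ring.
  have K i : dot a (v i) * H e i <=
      lam * (2 * `|dot a (v i)| + 4 * (rho i * (H e i / lam) ^+ (p + p))).
    rewrite (le_trans (ler_norm _))// normrM.
    have h2p : (H e i / lam) ^+ (p + p) = (`|H e i| / lam) ^+ (p + p).
      by rewrite !expr_div_n addnn -mul2n !exprM real_normK ?num_real.
    rewrite h2p; set h := `|H e i| / lam.
    have -> : `|H e i| = lam * h by rewrite mulrC divfK// gt_eqF.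
    have h0 : 0 <= h by rewrite divr_ge0// ltW.
    rewrite mulrCA ler_pM2l//; clearbody h.
    (* Where [h > 2], [h <= 2 h^(2p) / 4^p], and [4^p >= r] absorbs the factor
       [r] lost in the pointwise bound on [dot a (v i)]. *)
    have [h2|/ltW h2] := leP h 2.
      rewrite (le_trans (_ : _ <= 2 * `|dot a (v i)|))//.
        by rewrite mulrC ler_wpM2r.
      by rewrite lerDl !mulr_ge0// exprn_ge0.
    rewrite (le_trans (ler_wpM2r h0 (rhoP a Sa i)))//.
    rewrite ler_wpDl ?mulr_ge0//.
    have -> : 4 * (rho i * h ^+ (p + p)) = 2 * rho i * h * (2 * h ^+ (p + p).-1).
      have -> : h ^+ (p + p) = h * h ^+ (p + p).-1 by rewrite -exprS prednK ?addn_gt0 ?p0.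
      by ring.
    have -> : 2 * r%:R * rho i * h = 2 * rho i * h * r%:R by ring.
    apply: ler_wpM2l; first by rewrite !mulr_ge0.
    have : (r%:R : R) <= (4 ^ p)%:R by rewrite ler_nat.
    move=> /le_trans; apply.
    rewrite (_ : (4 ^ p)%:R = 2 * 2 ^+ (p + p).-1) ?ler_wpM2l//; last first.
      by rewrite -exprS prednK ?addn_gt0 ?p0// addnn -mul2n exprM -natrX -natrX.
    by rewrite ler_expn2r.
  rewrite (le_trans (ler_wpM2l _ (ler_sum _ (fun i _ => K i))))//.
  rewrite -mulr_sumr mulrCA /U ler_pM2l// big_split/= -!mulr_sumr mulrDr.
  by move: Sa; rewrite /S/=; set k := N^-1; lra.
rewrite (le_trans (ler_sum _ (fun e _ => HU e)))// -mulr_sumr big_split/=.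
rewrite sumr_const -mulr_sumr -mulr_sumr exchange_big/=.
under eq_bigr do rewrite -mulr_sumr.
have : N^-1 * \sum_i rho i * \sum_e (H e i / lam) ^+ (p + p) <= #|{: signs m}|%:R.
  rewrite (le_trans (ler_wpM2l _ (ler_sum _ (fun i _ => ler_wpM2l (rho0 i) (HE i)))))//.
  by rewrite -mulr_suml mulrA ler_piMl.
set x := N^-1 * _ => hx.
rewrite (le_trans (_ : _ <= lam * (2 *+ #|{: signs m}| + 4 * #|{: signs m}|%:R)))//.
  by rewrite ler_wpM2l ?lerD2l ?ler_wpM2l// ltW.
by rewrite -mulr_natr; lra.
Qed.

Let Sabs b := suprad S (fun j a => `|dot a (v (b, j))|).

Let sum_Sabs_le b : \sum_e Sabs b e <= #|{: signs m}|%:R * (6 * lam).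
Proof.
apply: le_trans (sum_suprad_le b); apply: (@contraction _ _ _ _ N); first by exists 0.
by move=> j a; apply: Sbound.
Qed.

Let Sabs_ub b e a : S a -> \sum_j sgn R e j * `|dot a (v (b, j))| <= Sabs b e.
Proof.
move=> Sa; apply: (@rad_le_suprad _ _ _ S N (fun j a => `|dot a (v (b, j))|)) => //.
by move=> j a' Sa'; rewrite normr_id Sbound.
Qed.

Let Sabs_ge0 b e : 0 <= Sabs b e.
Proof.
apply: le_trans (Sabs_ub b e S0); rewrite big1// => j _.
by rewrite dotC dot0r normr0 mulr0.
Qed.

(** [Sabs] is a one-sided supremum, so the lower bound comes from the opposite signs. Adding the two
    bounds is harmless since both are nonnegative. *)
Let Sabs_norm b e a : S a ->
  `|\sum_j sgn R e j * `|dot a (v (b, j))| | <= Sabs b e + Sabs b (negs e).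
Proof.
move=> Sa; have := Sabs_ub b e Sa; have := Sabs_ub b (negs e) Sa.
rewrite (eq_bigr (fun j => - (sgn R e j * `|dot a (v (b, j))|))) => [|j _]; last first.
  by rewrite sgn_negs mulNr.
rewrite sumrN ler_norml => h1 h2; have := Sabs_ge0 b e; have := Sabs_ge0 b (negs e).
by move=> h3 h4; apply/andP; split; lra.
Qed.

Let X b e := radsum (fun=> 1) (fun j => v (b, j)) e.

Let sum_trace_le b :
  \sum_e \tr (X b e ^+ (p + p)) <= #|{: signs m}|%:R * ((4 ^ p)%:R * lam ^+ (p + p)).
Proof.
rewrite (le_trans (@matrix_khintchine R r m (fun=> 1) _ (B * N) p p _ _ _))//.
- by rewrite mulr_ge0// ltW.
- move=> z; rewrite (le_trans (half_sum_le b
    (F := fun i => 1 ^+ 2 * dot (v i) (v i) * dot (v i) z ^+ 2) _))//.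
    by move=> i; rewrite expr1n mul1r mulr_ge0 ?dot_ge0 ?sqr_ge0.
  rewrite -mulrA -vN mulr_sumr; apply: ler_sum => i _.
  by rewrite expr1n mul1r (dotC z) ler_wpM2r ?sqr_ge0.
- rewrite lam2p -mulrA ler_wpM2l// ler_wpM2r ?ler_nat//.
  by rewrite exprn_ge0// ltW.
Qed.

(** [Y1] adds four suprema of mean at most [6 lam], and [Y2] two traces. Divided by [24 lam] and
    [c2], each has mean at most 1, so some [e] makes the sum of the two quotients at most 2, and
    then each of these nonnegative quotients is at most 2. *)
Lemma exists_signing : exists e : signs m, forall a,
  `|\sum_j sgn R e j * (`|dot a (v (true, j))| - `|dot a (v (false, j))|)|
     <= 48 * lam * (N^-1 * \sum_i `|dot a (v i)|) /\
  `|\sum_j sgn R e j * (dot a (v (true, j)) ^+ 2 - dot a (v (false, j)) ^+ 2)|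
     <= 8 * lam * dot a a.
Proof.
pose Y1 e := Sabs true e + Sabs true (negs e) + (Sabs false e + Sabs false (negs e)).
pose Y2 e := \tr (X true e ^+ (p + p)) + \tr (X false e ^+ (p + p)).
pose c2 := 2 * ((4 ^ p)%:R * lam ^+ (p + p)).
have c20 : 0 < c2 by rewrite !mulr_gt0 ?exprn_gt0// ltr0n expn_gt0.
have [e eP] : exists e, Y1 e / (24 * lam) + Y2 e / c2 <= 2.
  apply: exists_le_mean; first exact: [ffun=> true].
  rewrite big_split/= -!mulr_suml !big_split/= -!sum_negs.
  have := sum_trace_le true; have := sum_trace_le false.
  have := sum_Sabs_le true; have := sum_Sabs_le false.
  set w := #|_|%:R => h1 h2 h3 h4; rewrite -[2]/(1 + 1) mulrDr mulr1 lerD//.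
    by rewrite ler_pdivrMr ?mulr_gt0//; lra.
  by rewrite ler_pdivrMr// /c2; lra.
have Tge0 b : 0 <= \tr (X b e ^+ (p + p)).
  rewrite mxtraceE sumr_ge0// => k _; apply: dot_exp_even_ge0; exact: radsum_tr.
have Y10 : 0 <= Y1 e by rewrite !addr_ge0 ?Sabs_ge0.
have Y20 : 0 <= Y2 e by rewrite addr_ge0.
have Y1le : Y1 e <= 48 * lam.
  have : Y1 e / (24 * lam) <= 2 by rewrite (le_trans _ eP)// lerDl divr_ge0// ltW.
  by rewrite ler_pdivrMr ?mulr_gt0//; lra.
(* The bound [2 * c2] is [4 * 4^p * lam^(2p)], and [4 <= 4^p] because [p] is positive. *)
have Y2le : Y2 e <= (4 * lam) ^+ (p + p).
  have : Y2 e / c2 <= 2 by rewrite (le_trans _ eP)// lerDr divr_ge0// mulr_ge0// ltW.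
  rewrite ler_pdivrMr// => /le_trans; apply.
  rewrite /c2 exprMn !mulrA; apply: ler_wpM2r; first by rewrite exprn_ge0// ltW.
  rewrite exprD natrX; apply: ler_wpM2r; first by rewrite exprn_ge0.
  by rewrite -natrM -natrX ler_nat -{1}[(2 * 2)%N]expn1 leq_pexp2l.
exists e => a; split.
  have main a' : S a' -> `|\sum_j sgn R e j *
      (`|dot a' (v (true, j))| - `|dot a' (v (false, j))|)| <= 48 * lam.
    move=> Sa'; under eq_bigr do rewrite mulrBr.
    rewrite sumrB (le_trans (ler_normB _ _))// (le_trans _ Y1le)//.
    by rewrite lerD// Sabs_norm.
  set A := N^-1 * _; have A0 : 0 <= A by rewrite mulr_ge0 ?sumr_ge0.
  (* The bound over [S] extends by homogeneity, except when the L1 mean vanishes; then all the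
     values vanish. *)
  have [A00|An0] := eqVneq A 0.
    have d0 i : dot a (v i) = 0.
      apply/eqP; rewrite -normr_eq0; move/eqP: A00; rewrite mulf_eq0 invr_eq0 gt_eqF//=.
      by rewrite psumr_eq0// => /allP /(_ i (mem_index_enum _)).
    by rewrite A00 mulr0 big1 ?normr0// => j _; rewrite !d0 subrr mulr0.
  have {An0}A0 : 0 < A by rewrite lt_def An0.
  have AV b : `|dot (A^-1 *: a) b| = A^-1 * `|dot a b|.
    by rewrite dotZl normrM ger0_norm// invr_ge0 ltW.
  have /main : S (A^-1 *: a).
    rewrite /S/=; under eq_bigr do rewrite AV.
    by rewrite -mulr_sumr mulrCA -/A mulVf ?gt_eqF.
  under eq_bigr do rewrite !AV -mulrBr mulrCA.
  rewrite -mulr_sumr normrM [`|A^-1|]ger0_norm; last by rewrite invr_ge0 ltW.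
  by rewrite mulrC ler_pdivrMr.
have main b : `|\sum_j sgn R e j * dot a (v (b, j)) ^+ 2| <= 4 * lam * dot a a.
  have -> : \sum_j sgn R e j * dot a (v (b, j)) ^+ 2 = dot a (X b e *m a).
    by rewrite dot_radsum; apply: eq_bigr => j _; rewrite mulr1 (dotC a).
  apply: (quadratic_le_trace_root _ _ p0); first exact: radsum_tr.
    by rewrite mulr_ge0// ltW.
  apply: le_trans Y2le.
  by case: b; rewrite /Y2 ?lerDl ?lerDr.
under eq_bigr do rewrite mulrBr.
rewrite sumrB (le_trans (ler_normB _ _))//.
by have := main true; have := main false; lra.
Qed.

End Signing.

(** * Gram-Schmidt for a positive semidefinite form *)

Section GramSchmidt.
Variables (R : realType) (V : lmodType R) (X : set V) (b : V -> V -> R).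
Hypothesis XP : linear_subspace X.
Hypothesis bC : forall f g, b f g = b g f.
Hypothesis bL : forall c f g h, X f -> X g -> X h -> b (c *: f + g) h = c * b f h + b g h.
Hypothesis b_ge0 : forall f, 0 <= b f f.

Lemma subspace0 : X 0.
Proof. by case: XP; rewrite inE. Qed.

Lemma subspaceL c f g : X f -> X g -> X (c *: f + g).
Proof. by move=> Xf Xg; have := proj2 XP c f g; rewrite !inE; apply. Qed.

Lemma subspaceZ c f : X f -> X (c *: f).
Proof. by move=> Xf; rewrite -[_ *: _]addr0; apply: subspaceL => //; exact: subspace0. Qed.

Lemma subspaceD f g : X f -> X g -> X (f + g).
Proof. by move=> Xf Xg; rewrite -[f]scale1r; exact: subspaceL. Qed.

Lemma subspaceB f g : X f -> X g -> X (f - g).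
Proof. by move=> Xf Xg; rewrite addrC -scaleN1r; exact: subspaceL. Qed.

Lemma subspace_sum n (c : nat -> R) (u : nat -> V) :
  (forall k, (k < n)%N -> X (u k)) -> X (\sum_(k < n) c k *: u k).
Proof.
move=> Xu; apply: (big_ind X); first exact: subspace0; first exact: subspaceD.
by move=> k _; apply: subspaceZ; apply: Xu.
Qed.

Lemma form0 h : X h -> b 0 h = 0.
Proof.
move=> Xh; have := bL 1 subspace0 subspace0 Xh.
by rewrite scaler0 addr0; lra.
Qed.

Lemma formZ c f h : X f -> X h -> b (c *: f) h = c * b f h.
Proof. by move=> Xf Xh; rewrite -[_ *: _]addr0 bL ?form0 ?addr0//; exact: subspace0. Qed.

Lemma formD f g h : X f -> X g -> X h -> b (f + g) h = b f h + b g h.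
Proof. by move=> Xf Xg Xh; rewrite -[f in LHS]scale1r bL// mul1r. Qed.

Lemma form_sum n (c : nat -> R) (u : nat -> V) h :
  (forall k, (k < n)%N -> X (u k)) -> X h ->
  b (\sum_(k < n) c k *: u k) h = \sum_(k < n) c k * b (u k) h.
Proof.
elim: n => [|n IH] Xu Xh; first by rewrite !big_ord0 form0.
have Xun : X (u n) by exact: Xu.
have {}Xu k : (k < n)%N -> X (u k) by move=> /ltnW; exact: Xu.
have Xs := subspace_sum c Xu; have Xc := subspaceZ (c n) Xun.
by rewrite !big_ord_recr/= formD// formZ// IH.
Qed.

(** The value is [2 c b(f, g)]; being nonnegative for both [c] and [- c], it is zero. *)
Lemma form_null_lin c f g : X f -> X g -> b f f = 0 -> b g g = 0 ->
  b (c *: f + g) (c *: f + g) = 0.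
Proof.
move=> Xf Xg ff gg; have Xfg a := subspaceL a Xf Xg.
have E a : b (a *: f + g) (a *: f + g) = 2 * a * b f g.
  rewrite bL// bC (bC g) !bL// ff gg (bC g f); ring.
have := b_ge0 (c *: f + g); have := b_ge0 (- c *: f + g).
by rewrite !E; lra.
Qed.

(** Indexing by natural numbers lets the family grow by one vector without a change of type; only
    the indices below [r] count. *)
Definition orthonormal_family (r : nat) (u : nat -> V) :=
  (forall k, (k < r)%N -> X (u k)) /\
  (forall i j, (i < r)%N -> (j < r)%N -> b (u i) (u j) = (i == j)%:R).

Lemma form_orthonormal r u (c : nat -> R) j : orthonormal_family r u -> (j < r)%N ->
  b (\sum_(k < r) c k *: u k) (u j) = c j.
Proof.
move=> [Xu ou] jr; have Xj := Xu _ jr; rewrite form_sum// (bigD1 (Ordinal jr))//= ou// eqxx mulr1.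
rewrite big1 ?addr0// => i ij; rewrite ou// (_ : (i == j :> nat) = false) ?mulr0//.
exact: negbTE.
Qed.

Lemma form_orthonormal_sqr r u (c : nat -> R) : orthonormal_family r u ->
  b (\sum_(k < r) c k *: u k) (\sum_(k < r) c k *: u k) = \sum_(k < r) c k ^+ 2.
Proof.
move=> ou; have Xs := subspace_sum c (proj1 ou).
rewrite [LHS]form_sum//; last by case: ou.
by apply: eq_bigr => k _; rewrite bC form_orthonormal// expr2.
Qed.

(* The form may be degenerate on [X]: the residues are only null vectors. *)
Lemma gram_schmidt n : dim_le X n -> exists r u, [/\ (r <= n)%N, orthonormal_family r u &
  forall f, X f -> exists c : nat -> R,
    let g := f - \sum_(k < r) c k *: u k in b g g = 0].
Proof.
move=> [w Xw spanw].
suff H j : (j <= n)%N -> exists r u, [/\ (r <= j)%N, orthonormal_family r u &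
    forall i : 'I_n, (i < j)%N -> exists c : nat -> R,
      let g := w i - \sum_(k < r) c k *: u k in b g g = 0].
  have [r [u [rn ou spanu]]] := H n (leqnn n); exists r, u; split=> // f Xf.
  have [a ->] := spanw f Xf.
  have /choice[c cP] (i : 'I_n) : exists c : nat -> R,
      let g := w i - \sum_(k < r) c k *: u k in b g g = 0 by exact: spanu.
  exists (fun k => \sum_i a i * c i k) => /=.
  have -> : \sum_(i < n) a i *: w i - \sum_(k < r) (\sum_i a i * c i k) *: u k =
      \sum_i a i *: (w i - \sum_(k < r) c i k *: u k).
    rewrite [RHS](eq_bigr (fun i => a i *: w i - \sum_(k < r) (a i * c i k) *: u k)); last first.
      move=> i _; rewrite scalerBr scaler_sumr; congr (_ - _).
      by apply: eq_bigr => k _; rewrite scalerA.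
    rewrite [RHS]sumrB exchange_big/=; congr (_ - _).
    by apply: eq_bigr => k _; rewrite scaler_suml.
  suff [//] : b (\sum_i a i *: (w i - \sum_(k < r) c i k *: u k))
      (\sum_i a i *: (w i - \sum_(k < r) c i k *: u k)) = 0 /\
      X (\sum_i a i *: (w i - \sum_(k < r) c i k *: u k)).
  apply: (big_rec (fun g => b g g = 0 /\ X g)).
    by have X0 := subspace0; rewrite form0.
  move=> i g _ [gg Xg].
  have Xi : X (w i - \sum_(k < r) c i k *: u k).
    by apply: subspaceB => //; apply: subspace_sum; case: ou.
  by split; [apply: form_null_lin => //; exact: cP|exact: subspaceL].
elim: j => [|j IH] jn; first by exists 0%N, (fun=> 0); split.
have [r [u [rj ou spanu]]] := IH (ltnW jn).
have Xu := proj1 ou; pose wj := w (Ordinal jn).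
pose c k := b wj (u k); pose g := wj - \sum_(k < r) c k *: u k.
have Xg : X g by apply: subspaceB; [exact: Xw|exact: subspace_sum].
(* A null residue leaves the family as it is; otherwise the normalized residue is appended. *)
have [gg|gg] := eqVneq (b g g) 0.
  exists r, u; split=> //; first exact: ltnW.
  move=> i; rewrite ltnS leq_eqVlt => /orP[/eqP ij|]; last exact: spanu.
  exists c; rewrite (_ : w i = wj)//; congr w; exact: val_inj.
have s0 : 0 < Num.sqrt (b g g) by rewrite sqrtr_gt0 lt_def gg b_ge0.
set s := Num.sqrt _ in s0; have sE : b g g = s ^+ 2 by rewrite sqr_sqrtr.
pose u' k := if k == r then s^-1 *: g else u k.
have gu k : (k < r)%N -> b g (u k) = 0.
  move=> kr; rewrite /g -scaleN1r addrC bL//; [|exact: subspace_sum|exact: Xw|exact: Xu].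
  by rewrite form_orthonormal// /c; ring.
have u'u k : (k < r)%N -> u' k = u k by rewrite /u'; case: ltngtP.
have sum_u' (d : nat -> R) : \sum_(k < r.+1) d k *: u' k =
    \sum_(k < r) d k *: u k + d r *: (s^-1 *: g).
  rewrite big_ord_recr/= {2}/u' eqxx; congr (_ + _).
  by apply: eq_bigr => k _; rewrite u'u.
exists r.+1, u'; split=> //.
  have Xg' : X (s^-1 *: g) by exact: subspaceZ.
  split=> [k|i j']; rewrite !ltnS.
    by rewrite leq_eqVlt /u'; case: eqP => //= _; exact: Xu.
  rewrite /u' (leq_eqVlt i) (leq_eqVlt j'); case: (eqVneq i r) => [->|ir]; case: (eqVneq j' r) => [->|jr]//= ilt jlt.
  - by rewrite formZ// bC formZ// sE; field; rewrite gt_eqF.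
  - by rewrite formZ ?gu ?mulr0 //; exact: Xu.
  - by rewrite bC formZ ?gu ?mulr0 ?(negPf ir)//; exact: Xu.
  - exact: (proj2 ou).
move=> i; rewrite ltnS leq_eqVlt => /orP[/eqP ij|/spanu[d dP]].
  exists (fun k => if k == r then s else c k) => /=.
  rewrite (sum_u' (fun k => if k == r then s else c k)) eqxx scalerA mulfV ?gt_eqF// scale1r.
  rewrite (eq_bigr (fun k : 'I_r => c k *: u k)) => [|k _]; last by rewrite ltn_eqF.
  rewrite (_ : w i = wj); last by congr w; exact: val_inj.
  by rewrite [X in wj - X]addrC subrK subrr form0//; exact: subspace0.
exists (fun k => if k == r then 0 else d k) => /=; rewrite (sum_u' (fun k => if k == r then 0 else d k)) eqxx scale0r addr0.
by rewrite (eq_bigr (fun k : 'I_r => d k *: u k)) => [|k _]; last by rewrite ltn_eqF.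
Qed.

End GramSchmidt.

(** * Samples, and halving a sample once *)

Definition mean (R : realType) (T : Type) (N : nat) (x : nat -> T) (phi : T -> R) : R :=
  N%:R^-1 * \sum_(i < N) phi (x i).

Lemma mean_ge0 (R : realType) (T : Type) (N : nat) (x : nat -> T) (phi : T -> R) :
  (forall t, 0 <= phi t) -> 0 <= mean N x phi.
Proof. by move=> phi0; rewrite mulr_ge0 ?invr_ge0 ?sumr_ge0. Qed.

Lemma fct_combE (R : realType) (T : Type) (r : nat) (c : nat -> R) (u : nat -> T -> R) t :
  (\sum_(k < r) c k *: u k) t = \sum_(k < r) c k * u k t.
Proof.
by rewrite fct_sumE.
Qed.

Section Halving.
Variables (R : realType) (T : Type) (X : set (T -> R)) (n p : nat).
Hypothesis XP : linear_subspace X.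
Hypothesis Xn : dim_le X n.
Hypotheses (p0 : (0 < p)%N) (np : (n <= 4 ^ p)%N).

(** Keeping one point of each pair changes a mean by exactly [N^-1] times a signed sum of
    differences over the pairs, so [exists_signing] applies in coordinates orthonormal for the
    sample. Its L2 constant 8 is enlarged to 48 to share [del]. *)
Lemma halving (m : nat) (x : nat -> T) (B : R) : (0 < m)%N -> 0 < B ->
  (forall f t, X f -> f t ^+ 2 <= B * mean (m + m) x (fun s => f s ^+ 2)) ->
  let del := 48 * Num.sqrt ((4 * p)%:R * (B * (m + m)%:R)) / (m + m)%:R in
  exists x' : nat -> T, forall f, X f ->
    `|mean m x' (fun s => `|f s|) - mean (m + m) x (fun s => `|f s|)|
      <= del * mean (m + m) x (fun s => `|f s|) /\
    `|mean m x' (fun s => f s ^+ 2) - mean (m + m) x (fun s => f s ^+ 2)|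
      <= del * mean (m + m) x (fun s => f s ^+ 2).
Proof.
move=> m0 B0 XB del; set N := (m + m)%:R : R.
have N0 : 0 < N by rewrite ltr0n addn_gt0 m0.
have N1 : 1 <= N by rewrite ler1n addn_gt0 m0.
pose b (f g : T -> R) := mean (m + m) x (fun s => f s * g s).
have bC f g : b f g = b g f by congr (_ * _); apply: eq_bigr => i _; rewrite mulrC.
have bL c f g h : X f -> X g -> X h -> b (c *: f + g) h = c * b f h + b g h.
  move=> _ _ _; rewrite /b /mean mulrCA -mulrDr; congr (_ * _).
  rewrite mulr_sumr -big_split/=; apply: eq_bigr => i _.
  by rewrite mulrDl mulrA.
have b_ge0 f : 0 <= b f f by apply: mean_ge0 => t; rewrite -expr2 sqr_ge0.
have [r [u [rn ou spanu]]] := gram_schmidt XP bC bL b_ge0 Xn.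
pose idx (i : bool * 'I_m) : nat := if i.1 then i.2 : nat else (m + i.2)%N.
have sum_idx (F : nat -> R) : \sum_i F (idx i) = \sum_(i < m + m) F i.
  have -> : \sum_i F (idx i) = \sum_b \sum_j F (idx (b, j)).
    by rewrite pair_bigA; apply: eq_bigr => -[].
  by rewrite big_bool/= big_split_ord.
have idx_lt i : (idx i < m + m)%N.
  by rewrite /idx; case: ifP => _; rewrite ?ltn_add2l// ltn_addr.
pose v i : 'cV[R]_r := \col_k u k (x (idx i)).
have vE (c : nat -> R) i :
    dot (\col_k c k) (v i) = (\sum_(k < r) c k *: u k) (x (idx i)).
  by rewrite fct_combE; apply: eq_bigr => k _; rewrite !mxE.
(* A column vector as a coefficient function on the natural numbers, with value 0 beyond [r]. *)
pose co (a : 'cV[R]_r) (k : nat) : R := if insub k is Some k' then a k' 0 else 0.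
have coE a : \col_k co a k = a.
  by apply/matrixP => k j; rewrite ord1 mxE /co valK.
have vN a : \sum_i dot a (v i) ^+ 2 = N * dot a a.
  have := coE a; move: (co a) => c <-; under eq_bigr do rewrite vE.
  rewrite (sum_idx (fun i => (\sum_(k < r) c k *: u k) (x i) ^+ 2)).
  have -> : dot (\col_(k < r) c k) (\col_(k < r) c k) = \sum_(k < r) c k ^+ 2.
    by apply: eq_bigr => k _; rewrite !mxE expr2.
  have := form_orthonormal_sqr XP bC bL c ou; rewrite /b /mean => <-.
  by rewrite mulrA mulfV ?gt_eqF// mul1r; apply: eq_bigr => i _; rewrite expr2.
have meanN a : mean (m + m) x (fun s => (\sum_(k < r) co a k *: u k) s ^+ 2) = dot a a.
  rewrite /mean -(sum_idx (fun i => (\sum_(k < r) co a k *: u k) (x i) ^+ 2)).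
  under eq_bigr do rewrite -vE coE.
  by rewrite vN mulrA mulVf ?gt_eqF// mul1r.
(* The function with coefficients [v i] is the reproducing kernel at the [i]-th point: both its
   value there and its mean square are [dot (v i) (v i)]. *)
have vB i : dot (v i) (v i) <= B.
  have := XB _ (x (idx i)) (subspace_sum XP (co (v i)) (proj1 ou)).
  rewrite meanN -vE coE expr2.
  have [->|vi0] := eqVneq (dot (v i) (v i)) 0; first by move=> _; exact: ltW.
  by rewrite ler_pM2r// lt_def vi0 dot_ge0.
have rp : (r <= 4 ^ p)%N by exact: leq_trans np.
have [e eP] := exists_signing N1 B0 p0 rp vN vB.
(* Pair [j] consists of [x j] and [x (m + j)], and a sign -1 keeps the latter. The default [x 0]
   occurs only for indices not below [m], which [mean m] ignores. *)
pose x' j := if insub j is Some j' then if e j' then x (m + j)%N else x j else x 0%N.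
have mean_x' (phi : T -> R) : mean m x' phi - mean (m + m) x phi =
    N^-1 * \sum_j sgn R e j * (phi (x (idx (true, j))) - phi (x (idx (false, j)))).
  have E : \sum_(i < m + m) phi (x i) +
      \sum_j sgn R e j * (phi (x (idx (true, j))) - phi (x (idx (false, j)))) =
      2 * \sum_(j < m) phi (x' j).
    rewrite big_split_ord/= -!big_split/= mulr_sumr.
    apply: eq_bigr => j _; rewrite /x' valK /sgn /idx/=; case: (e j) => /=; ring.
  rewrite -[X in N^-1 * X](addKr (\sum_(i < m + m) phi (x i))) E mulrDr [RHS]addrC mulrN.
  congr (_ - _); rewrite mulrA; congr (_ * _).
  by rewrite /N natrD; field; rewrite -mulr2n mulrn_eq0 pnatr_eq0 -lt0n m0.
exists x' => f Xf; have [c] := spanu f Xf; set f' := \sum_(k < r) _ => /= fc.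
(* A null residue vanishes at the sample points only, which is all that the means see. *)
have ff' i : (i < m + m)%N -> f (x i) = f' (x i).
  move=> im; move/eqP: fc; rewrite /b /mean mulf_eq0 invr_eq0 gt_eqF//= psumr_eq0.
    move=> /allP /(_ (Ordinal im) (mem_index_enum _)) /=.
    by rewrite mulf_eq0 orbb subr_eq0 => /eqP.
  by move=> j _; rewrite -expr2 sqr_ge0.
pose a : 'cV[R]_r := \col_k c k.
have fv i : f (x (idx i)) = dot a (v i) by rewrite ff'// vE.
have mean_f (psi : R -> R) : mean (m + m) x (fun s => psi (f s)) = N^-1 * \sum_i psi (dot a (v i)).
  by rewrite /mean -(sum_idx (fun i => psi (f (x i)))); under eq_bigr do rewrite fv.
have [e1 e2] := eP a; split.
  rewrite mean_x' (mean_f Num.norm) normrM ger0_norm ?invr_ge0 ?ler0n//.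
  under eq_bigr do rewrite !fv.
  rewrite /del -/N [_ / N]mulrC -[X in _ <= X]mulrA ler_wpM2l// ?invr_ge0 ?ler0n//.
rewrite mean_x' (mean_f (fun t => t ^+ 2)) normrM ger0_norm ?invr_ge0 ?ler0n//.
under eq_bigr do rewrite !fv.
rewrite /del -/N [_ / N]mulrC -[X in _ <= X]mulrA ler_wpM2l ?invr_ge0 ?ler0n//.
rewrite vN mulKf ?gt_eqF// (le_trans e2)// ler_wpM2r ?dot_ge0// ler_wpM2r ?sqrtr_ge0//.
by rewrite ler_nat.
Qed.

End Halving.

(** * Repeated halving *)

Section Iteration.
Variables (R : realType) (T : Type) (X : set (T -> R)) (n p : nat) (B : R).
Hypothesis XP : linear_subspace X.
Hypothesis Xn : dim_le X n.
Hypotheses (p0 : (0 < p)%N) (np : (n <= 4 ^ p)%N) (B0 : 0 < B).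

(** Write [sig] for the square root at size [m]. The earlier halvings, down to size [2m], cost
    [576 * 3/4 sig = 432 sig], since the root of 1/2 is at most 3/4. The last one, with [2B] for
    [B], costs [96 sig] relative to a mean at most 3/2 of the original, that is [144 sig]. The sum
    is [576 sig] again. *)
Lemma repeated_halving (s m : nat) (x : nat -> T) : (0 < m)%N ->
  (forall f t, X f -> f t ^+ 2 <= B * mean (2 ^ s * m) x (fun s => f s ^+ 2)) ->
  576 * Num.sqrt (p%:R * B / m%:R) <= 2^-1 ->
  exists x' : nat -> T, forall f, X f ->
    `|mean m x' (fun s => `|f s|) - mean (2 ^ s * m) x (fun s => `|f s|)|
      <= 576 * Num.sqrt (p%:R * B / m%:R) * mean (2 ^ s * m) x (fun s => `|f s|) /\
    `|mean m x' (fun s => f s ^+ 2) - mean (2 ^ s * m) x (fun s => f s ^+ 2)|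
      <= 576 * Num.sqrt (p%:R * B / m%:R) * mean (2 ^ s * m) x (fun s => f s ^+ 2).
Proof.
elim: s m => [|s IH] m m0.
  rewrite mul1n => _ _; exists x => f Xf; rewrite !subrr normr0.
  by split; (apply: mulr_ge0; first by rewrite mulr_ge0 ?sqrtr_ge0 ?ler0n);
    apply: mean_ge0 => t; rewrite ?sqr_ge0.
have -> : (2 ^ s.+1 * m = 2 ^ s * (m + m))%N by rewrite expnS; lia.
move=> XB; set sig := Num.sqrt _ => sig2; have sig0 : 0 <= sig by exact: sqrtr_ge0.
have m0R : 0 < m%:R :> R by rewrite ltr0n.
have m00 : m%:R != 0 :> R by rewrite gt_eqF.
have mm00 : m%:R + m%:R != 0 :> R by rewrite gt_eqF ?addr_gt0.
have pBm0 : 0 <= p%:R * B / m%:R by rewrite divr_ge0// mulr_ge0// ltW.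
have sig_half : Num.sqrt (p%:R * B / (m + m)%:R) <= 3 / 4 * sig.
  have -> : 3 / 4 * sig = Num.sqrt ((3 / 4) ^+ 2 * (p%:R * B / m%:R)).
    by rewrite sqrtrM ?sqr_ge0// sqrtr_sqr ger0_norm ?divr_ge0.
  rewrite ler_sqrt; last by rewrite mulr_ge0 ?sqr_ge0.
  have -> : p%:R * B / (m + m)%:R = 2^-1 * (p%:R * B / m%:R).
    by rewrite natrD; field; rewrite ?m00 ?mm00.
  by apply: ler_wpM2r; [|lra].
have mm0 : (0 < m + m)%N by rewrite addn_gt0 m0.
have [|x' x'P] := IH (m + m)%N mm0 XB; first by lra.
have B20 : 0 < 2 * B by rewrite mulr_gt0.
(* The mean square over [x'] is at least half the original one, so doubling [B] once is enough,
   however many halvings came before. *)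
have XB' f t : X f -> f t ^+ 2 <= 2 * B * mean (m + m) x' (fun s => f s ^+ 2).
  move=> Xf; rewrite (le_trans (XB f t Xf))// mulrAC mulrC ler_pM2r//.
  have [_] := x'P f Xf; set a := mean _ x _; set b := mean _ x' _.
  have a0 : 0 <= a by apply: mean_ge0 => t'; rewrite sqr_ge0.
  have : 576 * Num.sqrt (p%:R * B / (m + m)%:R) * a <= 2^-1 * a by rewrite ler_wpM2r//; lra.
  by rewrite ler_norml => h /andP[]; lra.
have /= [x'' x''P] := halving XP Xn p0 np m0 B20 XB'.
have comb a b c : 0 <= a ->
    `|b - a| <= 576 * Num.sqrt (p%:R * B / (m + m)%:R) * a ->
    `|c - b| <= 48 * Num.sqrt ((4 * p)%:R * (2 * B * (m + m)%:R)) / (m + m)%:R * b ->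
    `|c - a| <= 576 * sig * a.
  move=> a0.
  have -> : 48 * Num.sqrt ((4 * p)%:R * (2 * B * (m + m)%:R)) / (m + m)%:R = 96 * sig.
    have -> : (4 * p)%:R * (2 * B * (m + m)%:R) = (4 * m%:R) ^+ 2 * (p%:R * B / m%:R).
      by rewrite natrM natrD; field; rewrite ?m00 ?mm00.
    rewrite sqrtrM ?sqr_ge0// sqrtr_sqr ger0_norm ?mulr_ge0// -/sig natrD.
    by field; rewrite ?m00 ?mm00.
  move=> h1; have {}h1 : `|b - a| <= 432 * sig * a.
    by rewrite (le_trans h1)// ler_wpM2r//; lra.
  have b32 : b <= 3 / 2 * a.
    have : 432 * sig * a <= 2^-1 * a by rewrite ler_wpM2r//; lra.
    by move: h1; rewrite ler_norml => /andP[_]; lra.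
  move=> h2; have {}h2 : `|c - b| <= 144 * sig * a.
    rewrite (le_trans h2)// (_ : 144 * sig * a = 96 * sig * (3 / 2 * a)); last by field.
    by rewrite ler_wpM2l// mulr_ge0.
  by move: h1 h2; rewrite !ler_norml => /andP[? ?] /andP[? ?]; apply/andP; split; lra.
exists x'' => f Xf; have [h1 h2] := x'P f Xf; have [h3 h4] := x''P f Xf.
split; [apply: (comb _ _ _ _ h1 h3)|apply: (comb _ _ _ _ h2 h4)].
  exact: mean_ge0.
by apply: mean_ge0 => t; rewrite sqr_ge0.
Qed.

End Iteration.

(** * Replacing the measure by an equally weighted sample *)

Section BoundedIntegrals.
Variables (R : realType) (d : measure_display) (T : measurableType d) (mu : probability T R).
Implicit Types (f g : T -> R).

Lemma bounded_integrable f (c : R) : measurable_fun setT f -> (forall t, `|f t| <= c) ->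
  mu.-integrable setT (EFin \o f).
Proof.
move=> mf fc; apply: measurable_bounded_integrable => //.
  by rewrite -ge0_fin_numE//; exact: fin_num_measure.
exists c; split; first exact: num_real.
by move=> y cy t _ /=; rewrite (le_trans (fc t))// ltW.
Qed.

Lemma Rintegral_sum (I : finType) (f : I -> T -> R) :
  (forall i, mu.-integrable setT (EFin \o f i)) ->
  \int[mu]_x (\sum_i f i x) = \sum_i \int[mu]_x f i x.
Proof.
move=> fint; rewrite /Rintegral.
under eq_integral do rewrite -sumEFin.
rewrite integral_sum// -sum_fine// => i _.
by apply: integrable_fin_num => //; exact: fint.
Qed.

Lemma Rintegral_cst1 (c : R) : \int[mu]_x c = c.
Proof.
rewrite Rintegral_cst// [X in fine X](_ : _ = 1%E) ?mulr1//.
exact: probability_setT.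
Qed.

Lemma Rintegral_finite_comp (C : finType) (cell : T -> C) (psi : C -> R) :
  (forall c, measurable (cell @^-1` [set c])) ->
  \int[mu]_x psi (cell x) = \sum_c psi c * fine (mu (cell @^-1` [set c])).
Proof.
move=> mcell; pose A c := cell @^-1` [set c].
have cI c : mu.-integrable setT (EFin \o (fun t => \1_(A c) t : R)).
  apply: (@bounded_integrable _ 1); first by apply: measurable_indic; exact: mcell.
  by move=> t; rewrite indicE; case: (_ \in _); rewrite ?normr1 ?normr0.
transitivity (\int[mu]_x \sum_c psi c * \1_(A c) x).
  apply: eq_Rintegral => t _; rewrite (bigD1 (cell t))//= indicE mem_set ?mulr1//.
  rewrite big1 ?addr0// => c /eqP ct; rewrite indicE memNset ?mulr0//.
  by move=> /esym.
rewrite Rintegral_sum; last first.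
  move=> c; apply: eq_integrable (integrableZl measurableT (psi c) (cI c)) => //.
apply: eq_bigr => c _; rewrite RintegralZl//; congr (_ * _).
by rewrite /Rintegral integral_indic ?setIT//; exact: mcell.
Qed.

End BoundedIntegrals.

Lemma sum_nth_pad (R : realType) (T : Type) (phi : T -> R) (pt : T) (s : seq T) (k : nat) :
  \sum_(i < size s + k) phi (nth pt s i) = \sum_(y <- s) phi y + k%:R * phi pt.
Proof.
rewrite big_split_ord/=; congr (_ + _); first by rewrite (big_nth pt) big_mkord.
rewrite (eq_bigr (fun=> phi pt)) ?sumr_const ?card_ord ?mulr_natl// => i _.
by rewrite nth_default// leq_addr.
Qed.

(* The weights [w c] are rounded down to multiples of [1/M]; the mass lost is
   put at an arbitrary point. *)
Lemma equal_weight_rounding (R : realType) (T : pointedType) (C : finType) (rep : C -> T)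
    (w : C -> R) (M : nat) : (0 < M)%N -> (forall c, 0 <= w c) -> \sum_c w c = 1 ->
  exists x : nat -> T, forall phi : T -> R, (forall t, 0 <= phi t <= 1) ->
    `|mean M x phi - \sum_c w c * phi (rep c)| <= #|C|%:R / M%:R.
Proof.
move=> M0 w0 w1; pose n c := Num.truncn (w c * M%:R).
have wM0 c : 0 <= w c * M%:R by rewrite mulr_ge0.
have nle c : (n c)%:R <= w c * M%:R by have /andP[] := truncn_itv (wM0 c).
have nge c : w c * M%:R < (n c)%:R + 1.
  by have /andP[_] := truncn_itv (wM0 c); rewrite -natr1.
pose s := flatten [seq nseq (n c) (rep c) | c <- index_enum C].
have sum_s (phi : T -> R) : \sum_(y <- s) phi y = \sum_c (n c)%:R * phi (rep c).
  rewrite big_flatten big_map; apply: eq_bigr => c _.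
  by rewrite big_nseq iter_addr_0 mulr_natl.
have sizeE : (size s)%:R = \sum_c (n c)%:R :> R.
  have := sum_s (fun=> 1); rewrite big_const_seq count_predT iter_addr_0 => ->.
  by apply: eq_bigr => c _; rewrite mulr1.
have sumM : \sum_c w c * M%:R = M%:R by rewrite -mulr_suml w1 mul1r.
have sM : (size s <= M)%N.
  by rewrite -(ler_nat R) sizeE -[leRHS]sumM; apply: ler_sum => c _.
exists (nth point s) => phi phi01.
have MR : 0 < M%:R :> R by rewrite ltr0n.
have phi0 t : 0 <= phi t by have /andP[] := phi01 t.
have phi1 t : phi t <= 1 by have /andP[] := phi01 t.
(* Two errors remain, the mass added at [point] and the mass lost by rounding down; each lies
   between 0 and the number of cells, divided by [M]. *)
have -> : mean M (nth point s) phi - \sum_c w c * phi (rep c) =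
    ((M - size s)%:R * phi point - \sum_c (w c * M%:R - (n c)%:R) * phi (rep c)) / M%:R.
  have := sum_nth_pad phi point s (M - size s); rewrite subnKC// sum_s /mean => ->.
  have -> : \sum_c (w c * M%:R - (n c)%:R) * phi (rep c) =
      M%:R * (\sum_c w c * phi (rep c)) - \sum_c (n c)%:R * phi (rep c).
    by rewrite mulr_sumr -sumrB; apply: eq_bigr => c _; ring.
  by field; rewrite gt_eqF.
rewrite normrM [`|M%:R^-1|]ger0_norm ?invr_ge0// ler_pM2r ?invr_gt0//.
have lost : (M - size s)%:R = \sum_c (w c * M%:R - (n c)%:R) :> R.
  by rewrite natrB// sizeE sumrB sumM.
have lost_le : \sum_c (w c * M%:R - (n c)%:R) <= #|C|%:R.
  rewrite -[leRHS]mulr1 mulr_natl -sumr_const; apply: ler_sum => c _.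
  by rewrite lerBlDl ltW.
have l0 c : 0 <= w c * M%:R - (n c)%:R by rewrite subr_ge0.
have h1 : 0 <= \sum_c (w c * M%:R - (n c)%:R) * phi (rep c).
  by apply: sumr_ge0 => c _; rewrite mulr_ge0.
have h2 : \sum_c (w c * M%:R - (n c)%:R) * phi (rep c) <= #|C|%:R.
  by apply: le_trans lost_le; apply: ler_sum => c _; rewrite ler_piMr.
have h3 : 0 <= (M - size s)%:R * phi point by rewrite mulr_ge0.
have h4 : (M - size s)%:R * phi point <= #|C|%:R.
  by apply: le_trans lost_le; rewrite -lost ler_piMr.
by rewrite ler_norml; apply/andP; split; lra.
Qed.

(** The values of the [u k] are cut into levels of width [h], so that [phi] varies by at most
    [eta / 2] on a cell. Replacing it by its values at representatives costs [eta / 2], and rounding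
    the cell measures costs as much. The sample is chosen before [phi]. *)
Lemma discretization (R : realType) (d : measure_display) (T : measurableType d)
    (mu : probability T R) (r : nat) (u : nat -> T -> R) (b eta : R) :
  (forall k, (k < r)%N -> measurable_fun setT (u k)) ->
  (forall k t, (k < r)%N -> `|u k t| <= b) -> 0 < eta ->
  exists M0, forall M, (M0 <= M)%N -> (0 < M)%N ->
  exists x : nat -> T, forall phi : T -> R, measurable_fun setT phi ->
    (forall t, 0 <= phi t <= 1) ->
    (forall t t', `|phi t - phi t'| <= \sum_(k < r) `|u k t - u k t'|) ->
    `|mean M x phi - \int[mu]_t phi t| <= eta.
Proof.
(* [r.+1] instead of [r] keeps the denominator positive when [r = 0]. *)
move=> mu_ ub eta0; have [h h0 hE] : exists2 h, 0 < h & h = eta / (2 * r.+1%:R).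
  by eexists; last reflexivity; rewrite divr_gt0// mulr_gt0.
pose q k t := Num.truncn ((u k t + b) / h).
have arg0 k t : (k < r)%N -> 0 <= (u k t + b) / h.
  move=> kr; rewrite divr_ge0 ?(ltW h0)//.
  by have := ub k t kr; rewrite ler_norml => /andP[]; lra.
pose L := Num.truncn ((b + b) / h).
have qL k t : (k < r)%N -> (q k t < L.+1)%N.
  move=> kr; rewrite ltnS; apply: le_truncn; rewrite ler_pM2r ?invr_gt0// lerD2r.
  by rewrite (le_trans (ler_norm _))// ub.
pose cell t : {ffun 'I_r -> 'I_L.+1} := [ffun k => inord (q (nat_of_ord k) t)].
have cell_close t t' k : (k < r)%N -> cell t = cell t' -> `|u k t - u k t'| <= h.
  move=> kr /ffunP /(_ (Ordinal kr)); rewrite !ffunE /= => /(congr1 val) /=.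
  rewrite !inordK ?qL// => qq.
  have /andP[h1 h2] := truncn_itv (arg0 k t kr).
  have /andP[h3 h4] := truncn_itv (arg0 k t' kr).
  move: h1 h2 h3 h4; rewrite -!/(q _ _) qq -!natr1.
  rewrite !ler_pdivlMr// !ltr_pdivrMr// => h1 h2 h3 h4.
  by rewrite ler_norml; apply/andP; split; lra.
have mcell c : measurable (cell @^-1` [set c]).
  have -> : cell @^-1` [set c] = \bigcap_(k in [set: 'I_r])
     ((u k) @^-1` `[(c k)%:R * h - b, (c k).+1%:R * h - b[%classic).
    apply/seteqP; split=> t /= tc.
      move=> k _ /=; rewrite in_itv/=; move: tc => /ffunP /(_ k); rewrite ffunE => /(congr1 val).
      rewrite /= inordK ?qL// => <-.
      have /andP[h1 h2] := truncn_itv (arg0 k t (ltn_ord k)).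
      move: h1 h2; rewrite -!/(q _ _) ler_pdivlMr// ltr_pdivrMr// => h1 h2.
      by apply/andP; split; lra.
    apply/ffunP => k; have := tc k I; rewrite /= in_itv/= ffunE => /andP[h1 h2].
    apply/val_inj => /=; rewrite inordK ?qL//.
    apply: truncn_def; rewrite ler_pdivlMr// ltr_pdivrMr//.
    by apply/andP; split; lra.
  apply: fin_bigcap_measurable => // k _.
  by rewrite -[X in measurable X]setTI; apply: mu_.
(* An empty cell gets the default [point]; its measure is zero. *)
pose rep c := if pselect (exists t, cell t = c) is left e then projT1 (cid e) else point.
have repP t : cell (rep (cell t)) = cell t.
  by rewrite /rep; case: pselect => [e|[]]; [exact: projT2 (cid e)|exists t].
pose w c := fine (mu (cell @^-1` [set c])).
have w0 c : 0 <= w c by rewrite fine_ge0.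
have w1 : \sum_c w c = 1.
  have := Rintegral_finite_comp mu (fun=> 1) mcell; rewrite Rintegral_cst1 => ->.
  by apply: eq_bigr => c _; rewrite mul1r.
(* Large enough for the rounding error, the number of cells over [M], to be at most [eta / 2]. *)
exists (Num.truncn (2 * #|{ffun 'I_r -> 'I_L.+1}|%:R / eta)).+1 => M MM M0.
have [x xP] := equal_weight_rounding rep M0 w0 w1; exists x => phi mphi phi01 philip.
have cardM : #|{ffun 'I_r -> 'I_L.+1}|%:R / M%:R <= eta / 2.
  rewrite ler_pdivrMr ?ltr0n//.
  have := truncnS_gt (2 * #|{ffun 'I_r -> 'I_L.+1}|%:R / eta).
  rewrite ltr_pdivrMr// => hh; have : (Num.truncn (2 * #|{ffun 'I_r -> 'I_L.+1}|%:R / eta)).+1%:R * eta <= M%:R * eta.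
    by rewrite ler_pM2r// ler_nat.
  by lra.
have close t : `|phi t - phi (rep (cell t))| <= eta / 2.
  rewrite (le_trans (philip _ _))//.
  have H (k : 'I_r) : `|u k t - u k (rep (cell t))| <= h by apply: cell_close; rewrite ?repP.
  rewrite (le_trans (ler_sum _ (fun k _ => H k)))// sumr_const card_ord -[h *+ r]mulr_natl.
  have {}hE : eta / 2 = r.+1%:R * h.
    by rewrite hE invfM mulrCA [X in _ = _ * X]mulrCA mulfV ?mulr1// pnatr_eq0.
  by rewrite hE; apply: ler_wpM2r; [exact: ltW|rewrite ler_nat].
have phi_int : mu.-integrable setT (EFin \o phi).
  apply: (@bounded_integrable _ _ _ _ _ 1) => // t.
  by have /andP[? ?] := phi01 t; rewrite ger0_norm.
pose g t := phi (rep (cell t)).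
have mg : measurable_fun setT g.
  move=> _ Y mY; rewrite setTI (_ : g @^-1` Y = \bigcup_(c in [set c | Y (phi (rep c))]) cell @^-1` [set c]).
    by apply: fin_bigcup_measurable.
  apply/seteqP; split=> [t tY|t [c cY tc]]; first by exists (cell t).
  by rewrite /g /= tc.
have g_int : mu.-integrable setT (EFin \o g).
  apply: (@bounded_integrable _ _ _ _ _ 1) => // t.
  by have /andP[? ?] := phi01 (rep (cell t)); rewrite ger0_norm.
have gE : \int[mu]_t g t = \sum_c w c * phi (rep c).
  rewrite (Rintegral_finite_comp mu (fun c => phi (rep c)) mcell).
  by apply: eq_bigr => c _; rewrite mulrC.
have cst_int c : mu.-integrable setT (EFin \o cst c) by exact: finite_measure_integrable_cst.
have int_close : `|\int[mu]_t g t - \int[mu]_t phi t| <= eta / 2.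
  have up : \int[mu]_t phi t <= \int[mu]_t g t + eta / 2.
    rewrite -[X in _ + X](Rintegral_cst1 mu) -RintegralD//; last exact: cst_int.
    apply: le_Rintegral => //.
      have := integrableD measurableT g_int (cst_int (eta / 2)).
      by apply: eq_integrable.
    by move=> t _; have := close t; rewrite ler_norml => /andP[]; rewrite /g; lra.
  have lo : \int[mu]_t g t <= \int[mu]_t phi t + eta / 2.
    rewrite -[X in _ + X](Rintegral_cst1 mu) -RintegralD//; last exact: cst_int.
    apply: le_Rintegral => //.
      have := integrableD measurableT phi_int (cst_int (eta / 2)).
      by apply: eq_integrable.
    by move=> t _; have := close t; rewrite ler_norml => /andP[]; rewrite /g; lra.
  by rewrite ler_norml; apply/andP; split; lra.
have := xP phi phi01; rewrite -gE => xP'.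
have -> : mean M x phi - \int[mu]_t phi t =
  (mean M x phi - \int[mu]_t g t) + (\int[mu]_t g t - \int[mu]_t phi t) by ring.
by rewrite (le_trans (ler_normD _ _))//; lra.
Qed.

(** * Sampling for spaces of bounded measurable functions *)

Lemma log4_exponent (R : realType) (n : nat) : (2 <= n)%N ->
  exists p, [/\ (0 < p)%N, (n <= 4 ^ p)%N & p%:R * ln 2 <= 2 * ln n%:R :> R].
Proof.
move=> n2; have n0 : (0 < n)%N by exact: leq_trans n2.
(* This is the number of binary digits of [n]: [n < 2^p], and [2^p <= 2 n <= n^2] because [n] is at
   least 2. *)
exists (trunc_log 2 n).+1; split=> //.
  rewrite (leq_trans (ltnW (trunc_log_ltn n (isT : 1 < 2)%N)))//.
  by rewrite -[4%N]/(2 ^ 2)%N -expnM leq_pexp2l// mulSn mul1n leq_addr.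
have -> : 2 * ln n%:R = ln ((n * n)%:R) :> R.
  by rewrite natrM lnM ?posrE ?ltr0n//; ring.
rewrite mulr_natl -lnXn// ler_ln ?posrE ?exprn_gt0 ?ltr0n ?muln_gt0 ?n0//.
rewrite -natrX ler_nat expnS leq_mul//.
exact: trunc_logP.
Qed.

Section SampleFromMeasure.
Variables (R : realType) (d : measure_display) (T : measurableType d) (mu : probability T R).
Variables (X : set (T -> R)) (n : nat) (B : R).
Hypotheses (XP : linear_subspace X) (Xn : dim_le X n) (B1 : 1 <= B).
Hypothesis X_meas : forall f, X f -> measurable_fun setT f.
Hypothesis X_bounded : forall f, X f -> exists c, forall t, `|f t| <= c.
Hypothesis nikolskii : forall f t, X f -> f t ^+ 2 <= B * \int[mu]_s (f s ^+ 2).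

Let B0 : 0 < B. Proof. exact: lt_le_trans ltr01 B1. Qed.

Let Bge0 : 0 <= B. Proof. exact: ltW. Qed.

Lemma integrable_mul f g : X f -> X g -> mu.-integrable setT (EFin \o (fun t => f t * g t)).
Proof.
move=> Xf Xg; have [c fc] := X_bounded Xf; have [c' gc] := X_bounded Xg.
apply: (@bounded_integrable _ _ _ _ _ (c * c')).
  by apply: measurable_funM; exact: X_meas.
by move=> t; rewrite normrM ler_pM.
Qed.

Lemma integrable_norm_fun f : X f -> mu.-integrable setT (EFin \o (fun t => `|f t|)).
Proof.
move=> Xf; have [c fc] := X_bounded Xf.
apply: (@bounded_integrable _ _ _ _ _ c); last by move=> t; rewrite normr_id.
by apply: measurableT_comp => //; exact: X_meas.
Qed.

(* With respect to an orthonormal basis of [X] in [L2(mu)], either norm of [f]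
   controls the coefficients, hence the oscillation, of [f]. *)
Lemma sample_from_measure (del : R) : 0 < del ->
  exists M0, forall M, (M0 <= M)%N -> (0 < M)%N ->
  exists x : nat -> T, forall f, X f ->
    `|mean M x (fun t => `|f t|) - \int[mu]_t `|f t| | <= del * \int[mu]_t `|f t| /\
    `|mean M x (fun t => f t ^+ 2) - \int[mu]_t (f t ^+ 2)|
      <= del * \int[mu]_t (f t ^+ 2).
Proof.
move=> del0; pose b (f g : T -> R) := \int[mu]_t (f t * g t).
have bC f g : b f g = b g f by apply: eq_Rintegral => t _; rewrite mulrC.
have bL c f g h : X f -> X g -> X h -> b (c *: f + g) h = c * b f h + b g h.
  move=> Xf Xg Xh; rewrite /b -RintegralZl//; last exact: integrable_mul.
  rewrite -RintegralD//; last exact: integrable_mul.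
    by apply: eq_Rintegral => t _; rewrite mulrDl mulrA.
  have := integrableZl measurableT c (integrable_mul Xf Xh).
  by apply: eq_integrable.
have b_ge0 f : 0 <= b f f by apply: Rintegral_ge0 => t _; rewrite -expr2 sqr_ge0.
have [r [u [rn ou spanu]]] := gram_schmidt XP bC bL b_ge0 Xn.
have Xu := proj1 ou.
have [bu bu_ub] : exists bu, forall k t, (k < r)%N -> `|u k t| <= bu.
  exists (Num.sqrt B) => k t kr; rewrite -sqrtr_sqr ler_sqrt//.
  rewrite (le_trans (nikolskii t (Xu k kr)))// ler_piMr//.
  have := proj2 ou k k kr kr; rewrite eqxx /b => h.
  by rewrite (_ : \int[mu]_s _ = 1)// -h; apply: eq_Rintegral => t' _; rewrite expr2.
(* [discretization] is applied below to [|f| / (B^2 I1)] and [f^2 / (2 B^2 I2)], for which this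
   [eta] gives relative errors [del / 2] and [del]. *)
pose eta := del / (2 * B ^+ 2).
have eta0 : 0 < eta by rewrite divr_gt0// mulr_gt0// exprn_gt0.
have [M0 M0P] := discretization mu (fun k kr => X_meas (Xu k kr)) bu_ub eta0.
exists M0 => M MM Mgt0; have [x xP] := M0P M MM Mgt0; exists x => f Xf.
set I1 := \int[mu]_t `|f t|; set I2 := \int[mu]_t (f t ^+ 2).
have I20 : 0 <= I2 by apply: Rintegral_ge0 => t _; rewrite sqr_ge0.
have I10 : 0 <= I1 by apply: Rintegral_ge0.
have [I2eq0|I2neq0] := eqVneq I2 0.
  have f0 t : f t = 0.
    have := nikolskii t Xf; rewrite -/I2 I2eq0 mulr0 => h.
    by apply/eqP; rewrite -sqrf_eq0 eq_le h sqr_ge0.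
  have -> : I1 = 0.
    rewrite /I1 (_ : (fun t => `|f t|) = fun=> 0) ?Rintegral_cst1//.
    by apply/funext => t; rewrite f0 normr0.
  rewrite I2eq0 mulr0 !subr0.
  rewrite /mean [X in _ * X]big1 => [|i _]; last by rewrite f0 normr0.
  rewrite [X in _ /\ `|_ * X| <= _]big1 => [|i _]; last by rewrite f0 expr0n.
  by rewrite mulr0 normr0.
have I2gt0 : 0 < I2 by rewrite lt_def I2neq0.
have [c cP] := spanu f Xf; move: cP; set f' := \sum_(k < r) _ => /= ff'.
have Xf' : X f' by exact: (subspace_sum XP c Xu).
(* The pointwise bound turns a null residue into a function that vanishes everywhere. *)
have fE t : f t = f' t.
  have := nikolskii t (subspaceB XP Xf Xf').
  have -> : \int[mu]_s ((f - f') s ^+ 2) = 0.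
    by rewrite -ff'; apply: eq_Rintegral => s _; rewrite expr2.
  rewrite mulr0 => h; have : (f - f') t ^+ 2 == 0 by rewrite eq_le h sqr_ge0.
  by rewrite sqrf_eq0 subr_eq0 => /eqP.
have I2E : I2 = \sum_(k < r) c k ^+ 2.
  rewrite -(form_orthonormal_sqr XP bC bL c ou) -/f' /b.
  by apply: eq_Rintegral => t _; rewrite fE expr2.
pose s := Num.sqrt I2; have s0 : 0 < s by rewrite sqrtr_gt0.
have sge0 : 0 <= s by exact: ltW.
have ss : s ^+ 2 = I2 by rewrite sqr_sqrtr.
have cs (k : 'I_r) : `|c k| <= s.
  rewrite -sqrtr_sqr ler_sqrt// I2E (bigD1 k)//= lerDl.
  by apply: sumr_ge0 => i _; rewrite sqr_ge0.
have fs t : `|f t| <= B * s.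
  rewrite -(ler_pXn2r (isT : 0 < 2)%N) ?nnegrE ?mulr_ge0//.
  rewrite real_normK ?num_real// (le_trans (nikolskii t Xf))// exprMn ss -/I2.
  by rewrite ler_wpM2r// expr2 ler_peMl.
(* The L2 norm is controlled by the L1 norm: [s^2] is at most the sup of [|f|] times [I1], and that
   sup is at most [B s]. *)
have sI1 : s <= B * I1.
  rewrite -(ler_pM2r s0) -expr2 ss mulrAC /I1 -RintegralZl//; last exact: integrable_norm_fun.
  apply: le_Rintegral => //.
  - have := integrable_mul Xf Xf; apply: eq_integrable => //.
  - have := integrableZl measurableT (B * s) (integrable_norm_fun Xf).
    by apply: eq_integrable.
  - by move=> t _; rewrite -[f t ^+ 2]real_normK ?num_real// expr2 ler_wpM2r.
have I1gt0 : 0 < I1 by rewrite -(pmulr_rgt0 _ B0) (lt_le_trans s0).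
have flip t t' : `|f t - f t'| <= s * \sum_(k < r) `|u k t - u k t'|.
  rewrite !fE /f' !fct_combE -sumrB mulr_sumr (le_trans (ler_norm_sum _ _ _))//.
  by apply: ler_sum => k _; rewrite -mulrBr normrM ler_wpM2r.
have BB : B <= B ^+ 2 by rewrite expr2 ler_peMl.
have B20 : 0 < B ^+ 2 by rewrite exprn_gt0.
have mf := X_meas Xf.
have scale (phi : T -> R) (z : R) : 0 < z -> measurable_fun setT phi ->
    mu.-integrable setT (EFin \o phi) ->
    (forall t, 0 <= phi t <= z) ->
    (forall t t', `|phi t - phi t'| <= z * \sum_(k < r) `|u k t - u k t'|) ->
    `|mean M x phi - \int[mu]_t phi t| <= eta * z.
  move=> z0; have zge0 : 0 <= z^-1 by rewrite invr_ge0 ltW.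
  move=> mphi iphi phi_z philip.
  have := xP (fun t => z^-1 * phi t) _ _ _; rewrite RintegralZl//.
  have -> : mean M x (fun t => z^-1 * phi t) = z^-1 * mean M x phi.
    by rewrite /mean -mulr_sumr mulrCA.
  rewrite -mulrBr normrM ger0_norm// mulrC ler_pdivrMr//; apply.
  - by apply: measurable_funM.
  - move=> t; have /andP[h1 h2] := phi_z t; rewrite mulr_ge0//=.
    by rewrite mulrC ler_pdivrMr// mul1r.
  - move=> t t'; rewrite -mulrBr normrM ger0_norm//.
    by rewrite mulrC ler_pdivrMr// mulrC.
split.
  rewrite (le_trans (scale _ (B ^+ 2 * I1) _ _ _ _ _))//.
  - by rewrite mulr_gt0.
  - exact: measurableT_comp.
  - exact: integrable_norm_fun.
  - move=> t; rewrite normr_ge0/= (le_trans (fs t))// expr2 -mulrA.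
    by rewrite ler_wpM2l.
  - move=> t t'; rewrite (le_trans (ler_dist_dist _ _))// (le_trans (flip t t'))//.
    rewrite ler_wpM2r ?sumr_ge0// (le_trans sI1)//.
    by rewrite ler_wpM2r.
  - rewrite mulrA /eta ler_wpM2r// invfM [del * _]mulrA divfK ?gt_eqF//.
    by move: del0; lra.
rewrite (le_trans (scale _ (2 * B ^+ 2 * I2) _ _ _ _ _))//.
- by rewrite !mulr_gt0.
- by apply: measurable_funX.
- by have := integrable_mul Xf Xf; apply: eq_integrable => // t _; rewrite /= expr2.
- move=> t; rewrite sqr_ge0/= (le_trans (nikolskii t Xf))// ler_wpM2r//.
  by rewrite (le_trans BB)// ler_peMl ?ler1n// ltW.
- move=> t t'; rewrite subr_sqr normrM.
  have h : `|f t + f t'| <= 2 * (B * s).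
    by rewrite (le_trans (ler_normD _ _))//; have := fs t; have := fs t'; lra.
  rewrite (le_trans (ler_pM _ _ (flip t t') h))//.
  rewrite mulrAC ler_wpM2r ?sumr_ge0// -ss.
  rewrite (_ : s * (2 * (B * s)) = B * (2 * s ^+ 2)); last by ring.
  rewrite (_ : 2 * B ^+ 2 * s ^+ 2 = B ^+ 2 * (2 * s ^+ 2)); last by ring.
  by rewrite ler_wpM2r// mulr_ge0// sqr_ge0.
- by rewrite mulrA /eta divfK// gt_eqF// mulr_gt0.
Qed.

End SampleFromMeasure.

(** The initial sample errs by [eps / 4]. The halvings err by another [eps / 4], relative to sample
    means at most twice the integrals. The total is at most [3/4 eps]. *)
Lemma sampling (R : realType) (d : measure_display) (T : measurableType d)
    (mu : probability T R) (X : set (T -> R)) (n : nat) (K eps : R) :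
  linear_subspace X -> dim_le X n -> (2 <= n)%N -> 1 <= K -> 0 < eps < 1 ->
  (forall f, X f -> measurable_fun setT f) ->
  (forall f, X f -> exists c, forall t, `|f t| <= c) ->
  (forall f t, X f -> f t ^+ 2 <= K * n%:R * \int[mu]_s (f s ^+ 2)) ->
  exists m (x : nat -> T), [/\ (0 < m)%N,
    m%:R <= 8 * 2304 ^+ 2 / ln 2 * eps ^- 2 * K * n%:R * ln n%:R &
    forall f, X f ->
    `|mean m x (fun t => `|f t|) - \int[mu]_t `|f t| | <= eps * \int[mu]_t `|f t| /\
    `|mean m x (fun t => f t ^+ 2) - \int[mu]_t (f t ^+ 2)|
      <= eps * \int[mu]_t (f t ^+ 2)].
Proof.
move=> XP Xn n2 K1 /andP[eps0 eps1] Xmeas Xbd nik.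
have K0 : 0 < K by exact: lt_le_trans ltr01 K1.
have n1R : 1 <= n%:R :> R by rewrite ler1n ltnW.
have n0R : 0 < n%:R :> R by exact: lt_le_trans n1R.
have B1 : 1 <= K * n%:R by rewrite mulr_ege1.
have B0 : 0 < K * n%:R by rewrite mulr_gt0.
have [p [p0 np pln]] := log4_exponent R n2.
have ln2 : 0 < ln 2 :> R by rewrite ln_gt0// ltr1n.
have p1R : 1 <= p%:R :> R by rewrite ler1n.
have p0R : 0 < p%:R :> R by rewrite ltr0n.
(* The size at which [576 * sig], for the doubled bound [2 K n], equals [eps / 4]; here
   [2304 = 4 * 576]. Since [Q >= 1], rounding up at most doubles it. *)
pose Q := 2 * 2304 ^+ 2 * (p%:R * (K * n%:R)) / eps ^+ 2.
have e2 : 0 < eps ^+ 2 by rewrite exprn_gt0.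
have Q1 : 1 <= Q.
  rewrite ler_pdivlMr// mul1r (le_trans (_ : _ <= 1)) ?expr_le1 ?ltW//.
  by have := mulr_ege1 p1R B1; lra.
have Q0 : 0 < Q by exact: lt_le_trans Q1.
pose m := (Num.truncn Q).+1.
have m0R : 0 < m%:R :> R by rewrite ltr0n.
have Qm : Q <= m%:R by rewrite ltW// truncnS_gt.
have m2Q : m%:R <= 2 * Q.
  have /andP[h _] := truncn_itv (ltW Q0).
  by rewrite /m -natr1; lra.
have del0 : 0 < eps / 4 by rewrite divr_gt0.
have [M0 M0P] := sample_from_measure XP Xn B1 Xmeas Xbd nik del0.
(* The threshold [M0] also serves as the number of halvings, as [2^M0] exceeds it. *)
have MM : (M0 <= 2 ^ M0 * m)%N.
  by rewrite (leq_trans (ltnW (ltn_expl M0 (isT : 1 < 2)%N)))// leq_pmulr.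
have [|x0 x0P] := M0P _ MM; first by rewrite muln_gt0 expn_gt0.
have I2ge0 f : 0 <= \int[mu]_s (f s ^+ 2) by apply: Rintegral_ge0 => t _; rewrite sqr_ge0.
have I1ge0 (f : T -> R) : 0 <= \int[mu]_s `|f s| by apply: Rintegral_ge0.
have B20 : 0 < 2 * (K * n%:R) by rewrite mulr_gt0.
have nik0 f t : X f ->
    f t ^+ 2 <= 2 * (K * n%:R) * mean (2 ^ M0 * m) x0 (fun s => f s ^+ 2).
  move=> Xf; rewrite (le_trans (nik f t Xf))// -[X in _ <= X]mulrA [X in _ <= X]mulrCA ler_pM2l//.
  have [_] := x0P f Xf; have := I2ge0 f; set I := \int[mu]_s _ => I0.
  have : eps / 4 * I <= 4^-1 * I by rewrite ler_wpM2r//; lra.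
  by rewrite ler_norml => h /andP[]; lra.
set sig := Num.sqrt (p%:R * (2 * (K * n%:R)) / m%:R).
have sigeps : 576 * sig <= eps / 4.
  have -> : eps / 4 = 576 * Num.sqrt ((eps / 2304) ^+ 2).
    by rewrite sqrtr_sqr ger0_norm; [field|rewrite divr_ge0 ?(ltW eps0) ?ler0n].
  rewrite ler_pM2l ?ltr0n// ler_sqrt ?sqr_ge0// ler_pdivrMr//.
  move: Qm; rewrite ler_pdivrMr// => h.
  rewrite -(ler_pM2l (_ : 0 < 2304 ^+ 2)) ?exprn_gt0 ?ltr0n//.
  by rewrite (_ : 2304 ^+ 2 * ((eps / 2304) ^+ 2 * m%:R) = m%:R * eps ^+ 2); [lra|field].
have [|x xP] := @repeated_halving R T X n p _ XP Xn p0 np B20 M0 m x0 isT nik0.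
  by rewrite -/sig; lra.
exists m, x; split=> //.
  rewrite (le_trans m2Q)// (_ : 8 * 2304 ^+ 2 / ln 2 * eps ^- 2 * K * n%:R * ln n%:R =
    4 * 2304 ^+ 2 * (K * n%:R) / eps ^+ 2 * (2 * ln n%:R / ln 2)); last first.
    by field; rewrite !gt_eqF.
  rewrite (_ : 2 * Q = 4 * 2304 ^+ 2 * (K * n%:R) / eps ^+ 2 * p%:R); last first.
    by rewrite /Q; field; rewrite gt_eqF.
  rewrite ler_pM2l; first by rewrite ler_pdivlMr.
  have c0 : 0 < 4 * 2304 ^+ 2 :> R by rewrite -natrX -natrM ltr0n muln_gt0 expn_gt0.
  exact: divr_gt0 (mulr_gt0 c0 B0) e2.
have comb a b c : 0 <= a -> `|b - a| <= eps / 4 * a -> `|c - b| <= 576 * sig * b ->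
    `|c - a| <= eps * a.
  move=> a0 h1; have b0 : 0 <= b <= 2 * a.
    have : eps / 4 * a <= 4^-1 * a by rewrite ler_wpM2r//; lra.
    by move: h1; rewrite ler_norml => /andP[? ?] ?; apply/andP; split; lra.
  have /andP[b00 b2] := b0.
  move=> h2; have {}h2 : `|c - b| <= eps / 4 * (2 * a).
    rewrite (le_trans h2)// (le_trans (ler_wpM2r b00 sigeps))//.
    by rewrite ler_wpM2l// ltW.
  have ea : 0 <= eps * a by rewrite mulr_ge0// ltW.
  by move: h1 h2; rewrite !ler_norml => /andP[? ?] /andP[? ?]; apply/andP; split; lra.
move=> f Xf; have [h1 h2] := x0P f Xf; have [h3 h4] := xP f Xf.
by split; [exact: comb h1 h3|exact: comb h2 h4].
Qed.

(** * Continuous functions on a compact set *)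

Lemma compact_subtype (T : topologicalType) (A : set T) :
  compact A -> compact [set: set_type A].
Proof.
(* The filter is pushed forward to [T], where it clusters at a point of [A]; open sets of the
   subtype are traces of open sets of [T]. *)
move=> cA F FF _; have FA : (set_val @ F) A.
  by apply: (@filterS _ F _ setT) filterT => y _; exact: set_mem (valP y).
have FP : ProperFilter (set_val @ F) by exact: fmap_proper_filter.
have [p [Ap pF]] := cA (set_val @ F) FP FA.
exists (SigSub (mem_set Ap)); split=> // U V FU.
rewrite nbhsE => -[W [[W' oW' W'W] Wp] WV].
have : (set_val @ F) (set_val @` U) by apply: (@filterS _ F _ U) FU => y Uy; exists y.
move=> /pF /(_ (_ : nbhs p W')) [|q [[y Uy <-] W'y]].
  by apply: open_nbhs_nbhs; split=> //; move: Wp; rewrite -W'W.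
by exists y; split=> //; apply: WV; rewrite -W'W.
Qed.

Lemma continuous_borel_measurable (R : realType) (T : ptopologicalType) (f : T -> R) :
  continuous f -> measurable_fun [set: borelType T] (f : borelType T -> R).
Proof.
move=> /continuousP cf; apply: (measurability _ (RGenOpens.measurableE R)).
move=> _ [_ [a [b ->] <-]]; rewrite setTI.
by apply: sub_sigma_algebra; apply: cf; exact: interval_open.
Qed.

Theorem theorem1p1 (R : realType) :
  exists2 C : R, 0 < C &
  forall (d : nat) (Omega : set 'rV[R]_d) (Omega0 : Omega !=set0)
    (mu : probability (borelType (nonempty_subtype Omega0)) R)
    (n : nat) (K : R) (X : set (nonempty_subtype Omega0 -> R)),
  compact Omega ->
  (2 <= n)%N ->
  1 <= K ->
  linear_subspace X ->
  (forall f, X f -> continuous f) ->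
  dim_le X n ->
  (forall f, X f ->
     (sup_norm f <= (Num.sqrt (K * n%:R))%:E * 'N[mu]_2%:E[EFin \o f])%E) ->
  forall eps : R, 0 < eps < 1 ->
  exists (m : nat) (xi : 'I_m -> nonempty_subtype Omega0),
    [/\ (0 < m)%N,
        m%:R <= C * eps ^- 2 * K * n%:R * ln n%:R &
        forall f, X f ->
          ((1 - eps)%:E * 'N[mu]_1%:E[EFin \o f]
             <= (m%:R^-1 * \sum_(j < m) `|f (xi j)|)%:E
             <= (1 + eps)%:E * 'N[mu]_1%:E[EFin \o f])%E /\
          ((1 - eps)%:E * 'N[mu]_2%:E[EFin \o f] ^+ 2
             <= (m%:R^-1 * \sum_(j < m) `|f (xi j)| ^+ 2)%:E
             <= (1 + eps)%:E * 'N[mu]_2%:E[EFin \o f] ^+ 2)%E].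
Proof.
exists (8 * 2304 ^+ 2 / ln 2).
  apply: divr_gt0; last by rewrite ln_gt0// ltr1n.
  by rewrite -natrX -natrM ltr0n muln_gt0 expn_gt0.
move=> d Omega Omega0 mu n K X cO n2 K1 XP Xcont Xn nik eps eps01.
have Xmeas f : X f -> measurable_fun [set: borelType (nonempty_subtype Omega0)]
    (f : borelType (nonempty_subtype Omega0) -> R).
  by move=> Xf; apply: continuous_borel_measurable; exact: Xcont.
(* Compactness is used here: with boundedness, both norms are finite and can be handled as real
   numbers. *)
have Xbd f : X f -> exists c, forall t, `|f t| <= c.
  move=> Xf; have fc : {within [set: nonempty_subtype Omega0], continuous f}.
    by apply: continuous_subspaceT; exact: Xcont.
  have /compact_bounded[c [_ cP]] := continuous_compact fc (compact_subtype cO).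
  exists (c + 1) => t; apply: (cP (c + 1)); first by rewrite ltrDl.
  by exists t.
have fin1 f : X f -> mu.-integrable setT (EFin \o (fun t => `|f t|)).
  exact: (integrable_norm_fun mu Xmeas Xbd).
have fin2 f : X f -> mu.-integrable setT (EFin \o (fun t => f t ^+ 2)).
  by move=> Xf; have := integrable_mul mu Xmeas Xbd Xf Xf; apply: eq_integrable.
have N1 f : X f -> ('N[mu]_1%:E[EFin \o f])%E = (\int[mu]_t `|f t|)%:E.
  move=> Xf; rewrite Lnorm1 /Rintegral fineK//.
  by apply: integrable_fin_num => //; exact: fin1.
have I2 f : X f -> (\int[mu]_t (f t ^+ 2)%:E)%E = (\int[mu]_t (f t ^+ 2))%:E.
  move=> Xf; rewrite /Rintegral fineK//.
  by apply: integrable_fin_num => //; exact: fin2.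
have I2ge0 f : 0 <= \int[mu]_s (f s ^+ 2) by apply: Rintegral_ge0 => t _; rewrite sqr_ge0.
have N2 f : X f -> ('N[mu]_2%:E[EFin \o f])%E = (Num.sqrt (\int[mu]_t (f t ^+ 2)))%:E.
  move=> Xf; rewrite unlock.
  have -> : (\int[mu]_t (`|(EFin \o f) t| `^ 2) = \int[mu]_t (f t ^+ 2)%:E)%E.
    apply: eq_integral => t _; rewrite /= powR_mulrn// real_normK ?num_real//.
  by rewrite I2// poweR_EFin powR12_sqrt.
(* The bound on the supremum norm, read at one point and squared, has the form required by
   [sampling]. *)
have nik' f t : X f -> f t ^+ 2 <= K * n%:R * \int[mu]_s (f s ^+ 2).
  move=> Xf; have Kn : 0 <= K * n%:R by rewrite mulr_ge0// (le_trans ler01).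
  have h : `|f t| <= Num.sqrt (K * n%:R) * Num.sqrt (\int[mu]_s (f s ^+ 2)).
    rewrite -lee_fin EFinM -N2// (le_trans _ (nik f Xf))//.
    by apply: ereal_sup_ubound; exists t.
  rewrite -[f t ^+ 2]real_normK ?num_real// (le_trans (ler_expn2r 2 _ h))//.
  by rewrite exprMn !sqr_sqrtr.
have [m [x [m0 mC xP]]] := @sampling R _ (borelType (nonempty_subtype Omega0)) mu X n K eps XP Xn n2 K1 eps01
  Xmeas Xbd nik'.
exists m, (fun j => x j); split=> // f Xf; have [h1 h2] := xP f Xf.
rewrite N1// N2// -!EFin_expe -!EFinM !lee_fin sqr_sqrtr//.
have -> : m%:R^-1 * \sum_(j < m) `|f (x j)| ^+ 2 = mean m x (fun t => f t ^+ 2).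
  by congr (_ * _); apply: eq_bigr => j _; rewrite real_normK ?num_real.
rewrite -/(mean m x (fun t => `|f t|)); move: h1 h2; rewrite !ler_norml.
by move=> /andP[? ?] /andP[? ?]; split; apply/andP; split; lra.
Qed.
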